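(* Let $\Omega\subset\mathbb{R}^n$, $n\in\{2,3\}$, be a bounded polygonal/polyhedral Lipschitz domain with mesh $\mathcal{T}$, let $f\in L_2(\Omega)$, and let $U_h\subset U$ be a finite-dimensional subspace. Assume that $\|v\|\le d(\Omega)\,\|\nabla v\|$ for all $v\in H^1_0(\Omega)$ with a constant $d(\Omega)>0$, and choose the scaling parameter $d=d(\Omega)$. Let $\boldsymbol{u}\in U$ be the solution to $$b(\boldsymbol{u},\boldsymbol{v})=L(\boldsymbol{v})\quad\forall\,\boldsymbol{v}\in V.$$ Then the solution $\boldsymbol{u}_h\in U_h$ to the DPG scheme $$b(\boldsymbol{u}_h,\boldsymbol{v})=L(\boldsymbol{v})\quad\forall\,\boldsymbol{v}\in\Theta_d(U_h)$$ satisfies $$\|\boldsymbol{u}-\boldsymbol{u}_h\|_{U,d}\le 9\,\inf\{\|\boldsymbol{u}-\boldsymbol{w}\|_{U,d};\ \boldsymbol{w}\in U_h\}.$$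
   Context: Mesh: $\mathcal{T}$ is a finite collection of pairwise disjoint open Lipschitz subdomains (elements) $T\subset\Omega$ with $\bar\Omega=\bigcup_{T\in\mathcal{T}}\bar T$. $(\cdot,\cdot)_\omega$ and $\|\cdot\|_\omega$ are the $L_2(\omega)$ bilinear form and norm (index dropped for $\omega=\Omega$); $(\cdot,\cdot)_{\mathcal{T}}:=\sum_{T\in\mathcal{T}}(\cdot,\cdot)_T$ with differential operators applied elementwise. $\boldsymbol{L}_2(\Omega):=(L_2(\Omega))^n$. Broken spaces: $H^1(\mathcal{T}):=\prod_{T\in\mathcal{T}}H^1(T)$, $\boldsymbol{H}(\mathrm{div},\mathcal{T}):=\prod_{T\in\mathcal{T}}\boldsymbol{H}(\mathrm{div},T)$. Trace operators: $\mathrm{tr}^{\mathrm{grad}}:H^1(\mathcal{T})\to(\boldsymbol{H}(\mathrm{div},\mathcal{T}))'$ and $\mathrm{tr}^{\mathrm{div}}:\boldsymbol{H}(\mathrm{div},\mathcal{T})\to(H^1(\mathcal{T}))'$ are defined by $$\langle\mathrm{tr}^{\mathrm{grad}}(v),\boldsymbol{\delta\tau}\rangle_{\mathcal{S}}:=(v,\mathrm{div}\,\boldsymbol{\delta\tau})_{\mathcal{T}}+(\nabla v,\boldsymbol{\delta\tau})_{\mathcal{T}},\qquad \langle\mathrm{tr}^{\mathrm{div}}(\boldsymbol\tau),\delta v\rangle_{\mathcal{S}}:=(\boldsymbol\tau,\nabla\delta v)_{\mathcal{T}}+(\mathrm{div}\,\boldsymbol\tau,\delta v)_{\mathcal{T}}.$$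 Trace spaces: $H^{1/2}_{00}(\mathcal{S}):=\mathrm{tr}^{\mathrm{grad}}(H^1_0(\Omega))$, $H^{-1/2}(\mathcal{S}):=\mathrm{tr}^{\mathrm{div}}(\boldsymbol{H}(\mathrm{div},\Omega))$; their elements act on $\boldsymbol{H}(\mathrm{div},\mathcal{T})$ and $H^1(\mathcal{T})$, respectively, via $\langle\cdot,\cdot\rangle_{\mathcal{S}}$. Scaled norms: $\|v\|_{1,d,\omega}^2:=d^{-2}\|v\|_\omega^2+\|\nabla v\|_\omega^2$, $\|\boldsymbol\tau\|_{\mathrm{div},d,\omega}^2:=\|\boldsymbol\tau\|_\omega^2+d^2\|\mathrm{div}\,\boldsymbol\tau\|_\omega^2$ (index dropped for $\omega=\Omega$), $\|v\|_{1,d,\mathcal{T}}^2:=\sum_{T}\|v\|_{1,d,T}^2$, $\|\boldsymbol\tau\|_{\mathrm{div},d,\mathcal{T}}^2:=\sum_{T}\|\boldsymbol\tau\|_{\mathrm{div},d,T}^2$; $\|\widehat v\|_{1/2,d,\mathcal{S}}:=\inf\{\|v\|_{1,d};\ v\in H^1(\Omega),\ \mathrm{tr}^{\mathrm{grad}}(v)=\widehat v\}$ and $\|\widehat\tau\|_{-1/2,d,\mathcal{S}}:=\inf\{\|\boldsymbol\tau\|_{\mathrm{div},d};\ \boldsymbol\tau\in\boldsymbol{H}(\mathrm{div},\Omega),\ \mathrm{tr}^{\mathrm{div}}(\boldsymbol\tau)=\widehat\tau\}$. Trial and test spaces: $U:=L_2(\Omega)\times\boldsymbol{L}_2(\Omega)\times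 H^{1/2}_{00}(\mathcal{S})\times H^{-1/2}(\mathcal{S})$ with $$\|(u,\boldsymbol\sigma,\widehat u,\widehat\sigma)\|_{U,d}^2:=d^{-2}\|u\|^2+\|\boldsymbol\sigma\|^2+\|\widehat u\|_{1/2,d,\mathcal{S}}^2+\|\widehat\sigma\|_{-1/2,d,\mathcal{S}}^2,$$ and $V:=H^1(\mathcal{T})\times\boldsymbol{H}(\mathrm{div},\mathcal{T})$ with $\|(v,\boldsymbol\tau)\|_{V,d}^2:=\|v\|_{1,d,\mathcal{T}}^2+\|\boldsymbol\tau\|_{\mathrm{div},d,\mathcal{T}}^2$ and corresponding inner product $$\langle(v,\boldsymbol\tau),(\delta v,\boldsymbol{\delta\tau})\rangle_{V,d}:=d^{-2}(v,\delta v)+(\nabla v,\nabla\delta v)_{\mathcal{T}}+(\boldsymbol\tau,\boldsymbol{\delta\tau})+d^2(\mathrm{div}\,\boldsymbol\tau,\mathrm{div}\,\boldsymbol{\delta\tau})_{\mathcal{T}}.$$ Variational formulation (ultraweak formulation of $-\Delta u=f$ in $\Omega$, $u\in H^1_0(\Omega)$, i.e. reaction coefficient $\gamma=0$): for $\boldsymbol{u}=(u,\boldsymbol\sigma,\widehat u,\widehat\sigma)\in U$, $\boldsymbol{v}=(v,\boldsymbol\tau)\in V$, $$b(\boldsymbol{u},\boldsymbol{v}):=(u,\mathrm{div}\,\boldsymbol\tau)_{\mathcal{T}}+(\boldsymbol\sigma,\boldsymbol\tau+\nabla v)_{\mathcal{T}}-\langle\widehat u,\boldsymbol\tau\rangle_{\mathcal{S}}-\langle\widehat\sigma,v\rangle_{\mathcal{S}},\qquad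 L(\boldsymbol{v}):=(f,v).$$ Trial-to-test operator $\Theta_d:U\to V$: $\langle\Theta_d\boldsymbol{u},\boldsymbol{v}\rangle_{V,d}=b(\boldsymbol{u},\boldsymbol{v})$ for all $\boldsymbol{v}\in V$. *)

(* Defs.v *)
From HB Require Import structures.
From mathcomp Require Import all_boot all_order all_algebra.
From mathcomp Require Import all_classical all_reals all_analysis.

Set Implicit Arguments.
Unset Strict Implicit.
Unset Printing Implicit Defensive.

Import Order.TTheory GRing.Theory Num.Theory.
Import numFieldNormedType.Exports.
Local Open Scope classical_set_scope.
Local Open Scope ring_scope.

(* Row vectors carry the product sigma-algebra, generated by the coordinates;
   over a realType it is the Borel sigma-algebra of 'rV[R]_n. *)
Section measurable_rV.
Context {d} {T : measurableType d} (n : nat).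

Let coords : 'I_n -> 'rV[T]_n -> T := fun i x => x ord0 i.

Let rV_set0 : g_sigma_preimage coords set0.
Proof. exact: sigma_algebra0. Qed.

Let rV_setC A : g_sigma_preimage coords A -> g_sigma_preimage coords (~` A).
Proof. exact: sigma_algebraC. Qed.

Let rV_bigcup (F : _^nat) : (forall i, g_sigma_preimage coords (F i)) ->
  g_sigma_preimage coords (\bigcup_i (F i)).
Proof. exact: sigma_algebra_bigcup. Qed.

HB.instance Definition _ := @isMeasurable.Build (measure_tuple_display d)
  'rV[T]_n (g_sigma_preimage coords) rV_set0 rV_setC rV_bigcup.

End measurable_rV.

Lemma measurable_coord d (T : measurableType d) n (i : 'I_n) :
  measurable_fun [set: 'rV[T]_n] (fun x => x ord0 i).
Proof.
move=> _ Y mY; rewrite setTI; apply: sub_sigma_algebra => /=.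
rewrite -bigcup_seq/=; exists i => /=; first by rewrite mem_index_enum.
by exists Y => //; rewrite setTI.
Qed.

Lemma measurable_fun_rV d1 d2 (T1 : measurableType d1) (T2 : measurableType d2)
    n (f : T1 -> 'rV[T2]_n) :
  (forall i, measurable_fun [set: T1] (fun x => f x ord0 i)) ->
  measurable_fun [set: T1] f.
Proof.
move=> mf _ A mA; rewrite setTI.
suff : preimage_set_system [set: T1] f
    (g_sigma_preimage (fun (i : 'I_n) (x : 'rV[T2]_n) => x ord0 i))
    `<=` measurable.
  by apply; exists A => //; rewrite setTI.
rewrite -g_sigma_preimage_comp; apply: smallest_sub.
  exact: sigma_algebra_measurable.
case: n => [|n] in f mf A mA *; first by rewrite big_ord0.
rewrite -bigcup_mkord_ord; apply: bigcup_sub => i Ii.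
by move=> B [C mC <-]; exact: mf.
Qed.

Section lebesgue_rV.
Variable R : realType.

Definition consV n (p : R * 'rV[R]_n) : 'rV[R]_n.+1 :=
  row_mx (const_mx p.1 : 'rV_1) p.2.

Lemma measurable_consV n : measurable_fun [set: R * 'rV[R]_n] (@consV n).
Proof.
apply: measurable_fun_rV => i.
under eq_fun do rewrite mxE.
case: (fintype.split (i : 'I_(1 + n))) => j.
  by under eq_fun do rewrite mxE; exact: measurable_fst.
exact: (measurableT_comp (measurable_coord j) measurable_snd).
Qed.


Definition tailV n (x : 'rV[R]_n.+1) : R * 'rV[R]_n :=
  (x ord0 ord0, \row_j x ord0 (lift ord0 j)).

Lemma consVK n : cancel (@consV n) (@tailV n).
Proof.
case=> a v; rewrite /tailV; congr pair.
  by rewrite /consV mxE; case: splitP => // j _; rewrite mxE.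
apply/rowP => j; rewrite !mxE; case: splitP => [k /= |k].
  by rewrite ord1.
by rewrite /= /bump /= => -[jk]; congr (v _ _); exact/val_inj.
Qed.

Lemma tailVK n : cancel (@tailV n) (@consV n).
Proof.
move=> x; apply/rowP => i; rewrite mxE.
case: (splitP (i : 'I_(1 + n))) => j ij; rewrite mxE/=;
  by congr (x _ _); apply: val_inj; rewrite /= ?ij ?ord1.
Qed.

Lemma measurable_tailV n : measurable_fun [set: 'rV[R]_n.+1] (@tailV n).
Proof.
apply: measurable_fun_pair; first exact: measurable_coord.
apply: measurable_fun_rV => i.
by under eq_fun do rewrite mxE; exact: measurable_coord.
Qed.

Section step.
Local Open Scope ereal_scope.
Variables (n : nat) (mu : {sigma_finite_measure set 'rV[R]_n -> \bar R}).

Definition lebesgue_step : set 'rV[R]_n.+1 -> \bar R :=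
  pushforward (lebesgue_measure \x mu) (@consV n).

Let step0 : lebesgue_step set0 = 0.
Proof. by rewrite /lebesgue_step /pushforward preimage_set0 measure0. Qed.

Let step_ge0 A : 0 <= lebesgue_step A.
Proof. exact: (measure_ge0 (lebesgue_measure \x mu)). Qed.

Let step_sigma_additive : semi_sigma_additive lebesgue_step.
Proof.
have m_consV A : measurable A -> measurable (@consV n @^-1` A).
  by move=> mA; rewrite -[X in measurable X]setTI; exact: measurable_consV.
move=> F mF tF mUF; rewrite /lebesgue_step /pushforward preimage_bigcup.
apply: (measure_semi_sigma_additive (s := lebesgue_measure \x mu)).
- by move=> k; exact: m_consV.
- apply/trivIsetP => /= i j _ _ ij; rewrite -preimage_setI.
  by move/trivIsetP : tF => /(_ _ _ _ _ ij) ->//; rewrite preimage_set0.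
- by rewrite -preimage_bigcup; exact: m_consV.
Qed.

HB.instance Definition _ := isMeasure.Build _ _ _ lebesgue_step
  step0 step_ge0 step_sigma_additive.

Let step_sigma_finite : sigma_finite setT lebesgue_step.
Proof.
have /sigma_finiteP[F [FT ndF Foo]] := sigma_finiteT (@lebesgue_measure R).
have /sigma_finiteP[G [GT ndG Goo]] := sigma_finiteT mu.
exists (fun k => @tailV n @^-1` (F k `*` G k)).
  apply/esym; rewrite -preimage_bigcup -subTset => x _ /=.
  have [i _ Fi] : (\bigcup_k F k) (tailV x).1 by rewrite -FT.
  have [j _ Gj] : (\bigcup_k G k) (tailV x).2 by rewrite -GT.
  exists (maxn i j) => //; split.
    by move: Fi; exact/subsetPset/ndF/leq_maxl.
  by move: Gj; exact/subsetPset/ndG/leq_maxr.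
move=> k; have [mF Fk] := Foo k; have [mG Gk] := Goo k; split.
  by rewrite -[X in measurable X]setTI; apply: measurable_tailV => //;
    exact: measurableX.
rewrite /lebesgue_step /pushforward -comp_preimage.
rewrite (_ : _ \o _ = id); last by apply/funext => x; exact: consVK.
by rewrite preimage_id product_measure1E// lte_mul_pinfty// ge0_fin_numE.
Qed.

HB.instance Definition _ := Measure_isSigmaFinite.Build _ _ _ lebesgue_step
  step_sigma_finite.

End step.


(* The n-dimensional Lebesgue measure, as the n-fold product of the
   one-dimensional one; 'rV_0 is a single point of mass 1. *)
Fixpoint lebesgue_rV n : {sigma_finite_measure set 'rV[R]_n -> \bar R} :=
  match n with
  | 0 => \d_(0 : 'rV[R]_0)
  | k.+1 => lebesgue_step (lebesgue_rV k)
  end.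

End lebesgue_rV.

Section sobolev.
Variables (R : realType) (n : nat).
Local Notation E := 'rV[R]_n.
Implicit Types (A omega Omega : set E) (phi : E -> R).

Definition dot (x y : E) : R := \sum_(i < n) x ord0 i * y ord0 i.

(* Near each boundary point, A is the strict epigraph, in the direction of the
   unit vector e, of a Lipschitz function g of the component orthogonal to e. *)
Definition lipschitz_boundary A :=
  forall x0, (closure A `\` A) x0 ->
  exists (e : E) (g : E -> R) (k r : R),
    [/\ dot e e = 1, forall x t, g (x + t *: e) = g x, k.-lipschitz g, 0 < r &
        forall x, ball x0 r x -> (A x <-> g x < dot x e)].

Definition lipschitz_domain A :=
  [/\ open A, A !=set0, connected A & lipschitz_boundary A].

(* The closure is a finite union of finite intersections of half-spaces; for a
   bounded set these intersections are convex polytopes. *)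
Definition polyhedral A :=
  exists (K M : nat) (a : 'I_K -> 'I_M -> E) (c : 'I_K -> 'I_M -> R),
    closure A = \bigcup_k \bigcap_m [set x | dot (a k m) x <= c k m].

Record mesh Omega (N : nat) (T : 'I_N -> set E) : Prop := Mesh {
  mesh_lipschitz : forall i, lipschitz_domain (T i);
  mesh_sub : forall i, T i `<=` Omega;
  mesh_disjoint : trivIset setT T;
  mesh_cover : closure Omega = \bigcup_i closure (T i) }.

Definition ip omega (f g : E -> R) : R :=
  \int[lebesgue_rV R n]_(x in omega) (f x * g x).

Definition vip omega (f g : E -> E) : R :=
  \int[lebesgue_rV R n]_(x in omega) dot (f x) (g x).

Definition norm2 omega (f : E -> R) : R := Num.sqrt (ip omega f f).

Definition vnorm2 omega (f : E -> E) : R := Num.sqrt (vip omega f f).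

Definition L2 omega : set (E -> R) :=
  [set f : E -> R | measurable_fun omega f /\
    (\int[lebesgue_rV R n]_(x in omega) (f x ^+ 2)%:E < +oo)%E].

Definition vL2 omega : set (E -> E) :=
  [set f : E -> E | forall i, L2 omega (fun x => f x ord0 i)].

Definition partial (i : 'I_n) phi : E -> R := 'D_(delta_mx ord0 i) phi.

Definition grad phi : E -> E := fun x => \row_i partial i phi x.

Definition smooth phi := forall s : seq 'I_n,
  continuous (foldr partial phi s) /\
  forall i x, derivable (foldr partial phi s) x (delta_mx ord0 i).

Definition Cc_smooth omega : set (E -> R) :=
  [set phi : E -> R | [/\ smooth phi, compact (closure [set x | phi x != 0]) &
                 closure [set x | phi x != 0] `<=` omega]].

(* Weak derivatives being unique a.e., an element of H^1(omega) is recorded as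
   the pair (v, grad v), and one of H(div, omega) as the pair (tau, div tau). *)
Definition H1 omega : set ((E -> R) * (E -> E)) :=
  [set v : (E -> R) * (E -> E) | [/\ L2 omega v.1, vL2 omega v.2 &
    forall phi, Cc_smooth omega phi -> forall i,
      ip omega v.1 (partial i phi) = - ip omega (fun x => v.2 x ord0 i) phi]].

Definition Hdiv omega : set ((E -> E) * (E -> R)) :=
  [set tau : (E -> E) * (E -> R) | [/\ vL2 omega tau.1, L2 omega tau.2 &
    forall phi, Cc_smooth omega phi ->
      vip omega tau.1 (grad phi) = - ip omega tau.2 phi]].

Definition norm_H1 (d : R) omega (v : (E -> R) * (E -> E)) : R :=
  Num.sqrt (d ^- 2 * norm2 omega v.1 ^+ 2 + vnorm2 omega v.2 ^+ 2).

Definition norm_Hdiv (d : R) omega (tau : (E -> E) * (E -> R)) : R :=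
  Num.sqrt (vnorm2 omega tau.1 ^+ 2 + d ^+ 2 * norm2 omega tau.2 ^+ 2).

Definition H10 Omega : set ((E -> R) * (E -> E)) :=
  [set v | H1 Omega v /\ forall eps, 0 < eps ->
    exists2 phi, Cc_smooth Omega phi &
      norm_H1 1 Omega (v - (phi, grad phi)) < eps].

Section broken.
Variables (N : nat) (T : 'I_N -> set E).

Definition H1_broken : set ('I_N -> (E -> R) * (E -> E)) :=
  [set v | forall i, H1 (T i) (v i)].

Definition Hdiv_broken : set ('I_N -> (E -> E) * (E -> R)) :=
  [set tau | forall i, Hdiv (T i) (tau i)].

Definition tr_grad (v : 'I_N -> (E -> R) * (E -> E)) : Hdiv_broken -> R :=
  fun dtau => \sum_i (ip (T i) (v i).1 (\val dtau i).2 +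
                      vip (T i) (v i).2 (\val dtau i).1).

Definition tr_div (tau : 'I_N -> (E -> E) * (E -> R)) : H1_broken -> R :=
  fun dv => \sum_i (vip (T i) (tau i).1 (\val dv i).2 +
                    ip (T i) (tau i).2 (\val dv i).1).

(* A function on Omega is restricted to the mesh as a constant family. *)
Definition H12_00 Omega : set (Hdiv_broken -> R) :=
  [set tr_grad (fun=> v) | v in H10 Omega].

Definition Hm12 Omega : set (H1_broken -> R) :=
  [set tr_div (fun=> tau) | tau in Hdiv Omega].

Definition norm_12 (d : R) Omega (uhat : Hdiv_broken -> R) : R :=
  inf [set norm_H1 d Omega v |
       v in [set v | H1 Omega v /\ tr_grad (fun=> v) = uhat]].

Definition norm_m12 (d : R) Omega (shat : H1_broken -> R) : R :=
  inf [set norm_Hdiv d Omega tau |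
       tau in [set tau | Hdiv Omega tau /\ tr_div (fun=> tau) = shat]].

(* The vector space containing U: L_2 functions are given by representatives,
   elements of the trace spaces are functionals on the broken spaces. *)
Definition trial : lmodType R :=
  ((E -> R) * (E -> E) * (Hdiv_broken -> R) * (H1_broken -> R))%type.

Definition fld (u : trial) : E -> R := u.1.1.1.
Definition flux (u : trial) : E -> E := u.1.1.2.
Definition fld_trace (u : trial) : Hdiv_broken -> R := u.1.2.
Definition flux_trace (u : trial) : H1_broken -> R := u.2.

Definition U_space Omega : set trial :=
  [set u | [/\ L2 Omega (fld u), vL2 Omega (flux u),
               H12_00 Omega (fld_trace u) & Hm12 Omega (flux_trace u)]].

Definition norm_U (d : R) Omega (u : trial) : R :=
  Num.sqrt (d ^- 2 * norm2 Omega (fld u) ^+ 2 + vnorm2 Omega (flux u) ^+ 2 +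
            norm_12 d Omega (fld_trace u) ^+ 2 +
            norm_m12 d Omega (flux_trace u) ^+ 2).

Definition eq_U Omega (u w : trial) :=
  [/\ {ae lebesgue_rV R n, forall x, Omega x -> fld u x = fld w x},
      {ae lebesgue_rV R n, forall x, Omega x -> flux u x = flux w x},
      fld_trace u = fld_trace w & flux_trace u = flux_trace w].

(* The span of finitely many elements of U, closed under eq_U. *)
Definition fin_dim_subspace Omega (Uh : set trial) :=
  exists (m : nat) (e : 'I_m -> trial),
    (forall j, U_space Omega (e j)) /\
    Uh = [set w | U_space Omega w /\
                  exists c : 'I_m -> R, eq_U Omega w (\sum_j c j *: e j)].

Definition test : Type := (H1_broken * Hdiv_broken)%type.

Definition ip_V (d : R) (v dv : test) : R :=
  \sum_i (d ^- 2 * ip (T i) (\val v.1 i).1 (\val dv.1 i).1 +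
          vip (T i) (\val v.1 i).2 (\val dv.1 i).2 +
          vip (T i) (\val v.2 i).1 (\val dv.2 i).1 +
          d ^+ 2 * ip (T i) (\val v.2 i).2 (\val dv.2 i).2).

Definition bform (u : trial) (v : test) : R :=
  \sum_i ip (T i) (fld u) (\val v.2 i).2 +
  \sum_i vip (T i) (flux u) (fun x => (\val v.2 i).1 x + (\val v.1 i).2 x) -
  fld_trace u v.2 - flux_trace u v.1.

Definition load (f : E -> R) (v : test) : R :=
  \sum_i ip (T i) f (\val v.1 i).1.

(* The graph of the trial-to-test operator: all representatives v of
   Theta_d u. *)
Definition is_Theta (d : R) (u : trial) (v : test) :=
  forall dv, ip_V d v dv = bform u dv.

Definition Theta_image (d : R) (Uh : set trial) : set test :=
  [set v | exists2 w, Uh w & is_Theta d w v].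

End broken.
End sobolev.

(* Main.v *)
Require Import Defs.
From mathcomp Require Import all_boot all_order all_algebra.
From mathcomp Require Import all_classical all_reals all_analysis.
From mathcomp Require Import measurable_realfun ring lra.
Import Order.TTheory GRing.Theory Num.Theory.
Import numFieldNormedType.Exports.
Local Open Scope classical_set_scope.
Local Open Scope ring_scope.

Set Implicit Arguments.
Unset Strict Implicit.
Unset Printing Implicit Defensive.

(** Why the estimate holds. Let Theta be the trial-to-test operator, so that b(u, v)
is the inner product of Theta u with v. Everything rests on two inequalities for
u in the trial space, with all norms scaled by d:

- continuity, b(u, v)^2 <= 3 |u|^2 |v|^2 ([bform_bounded]);
- stability, |u|^2 <= 26 |Theta u|^2 ([stability]).

Let e be the error of the discrete solution and w any element of the discrete
space. The discrete equations say that Theta e is orthogonal to the image under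
Theta of the discrete space, hence
|Theta e|^2 = b(e, Theta e) = b(u - w, Theta e) <= sqrt 3 |u - w| |Theta e|,
and stability turns this into |e|^2 <= 78 |u - w|^2, where 78 <= 9^2
([quasi_optimality]).

Continuity is the Cauchy-Schwarz inequality. Stability comes from reading off what
Theta u = (v, tau) says about u = (u0, sigma, uhat, shat). Testing with fluxes only
shows that the function ut := u0 - d^2 div tau has weak gradient sigma - tau on the
whole domain and trace uhat ([tr_grad_potential], [potential_H1]). Testing with
scalar functions only shows that st := sigma - grad v has weak divergence
- d^-2 v on the whole domain and normal trace shat ([tr_div_conforming_flux],
[conforming_flux_Hdiv]). These two objects bound the quotient norms of the traces.
As uhat is the trace of a function vanishing on the boundary, ut is orthogonal to
st: (ut, div st) + (grad ut, st) = 0. Expanding this identity and using the Poincare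
inequality for ut bounds |grad ut| by d^-1 |v| + |grad v| + |tau|, and every
component of u is then controlled; the constant 26 is counted in [energy_arith].
The Poincare inequality is assumed in H^1_0 only, so it must be shown that ut
satisfies it: the H^1-orthogonal projection y of ut on H^1_0 leaves a remainder r
whose gradient lies in H(div) with divergence d^-2 r, and testing the trace of
ut - y with that gradient gives |r|^2 = 0 ([potential_poincare]).

Theta u exists by orthogonal projection on H^1(T) and H(div, T) element by element
([theta_exists]). Projections need completeness: L_2 is complete ([L2_complete]),
H^1 and H(div) are the orthogonal complements in products of L_2 of the pairs
made from test functions ([H1_orth], [Hdiv_orth]), and H^1_0 is closed by definition.
To use smooth test functions as elements of H^1 and H(div) one integrates by
parts ([ip_partial]); this follows from the translation invariance of Lebesgue
measure, as the integral of a derivative is the limit of integrals of difference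
quotients, all of which vanish ([integral_derive_eq0]). Finally, integrals over the
domain split into integrals over the elements because Lipschitz boundaries are null
([skeleton_null]): locally such a boundary is a graph, and infinitely many disjoint
translates of a graph fit into a bounded set ([lipschitz_graph_null]). *)

(** * Borel sets and negligible sets of row vectors *)

Section borel.
Variables (R : realType) (n : nat).
Local Notation E := 'rV[R]_n.
Local Notation mu := (lebesgue_rV R n).

Lemma ball_coordE (x : E) r :
  0 < r -> ball x r = \bigcap_(i in [set: 'I_n]) [set y : E | ball (x ord0 i) r (y ord0 i)].
Proof.
move=> r0; apply/seteqP; split=> y /=.
  by case=> _ xy i _; exact: xy.
by move=> xy; split=> // i j; rewrite ord1; exact: xy.
Qed.

Lemma measurable_ball_rV (x : E) r : measurable (ball x r).
Proof.
have [r0|r0] := ltP 0 r; last first.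
  by rewrite (_ : ball x r = set0) // -subset0 => y [/lt_le_trans/(_ r0)]; rewrite ltxx.
rewrite ball_coordE//; apply: fin_bigcap_measurable => [|i _]; first exact: finite_finset.
rewrite -[X in measurable X]setTI; apply: (measurable_coord i) => //.
exact: measurable_ball.
Qed.

(** A countable base of the topology: it makes open sets measurable for the
    product sigma-algebra, and reduces local nullity to countably many sets. *)
Definition rat_ball (q : 'rV[rat]_n * nat) : set E :=
  ball (map_mx (@ratr R) q.1) q.2.+1%:R^-1.

(** A ball of radius 1/(k+1) around a rational point within 1/(k+1) of x
    contains x and has diameter less than 2/(k+1). *)
Lemma nbhs_rat_ball (x : E) (U : set E) : nbhs x U ->
  exists q, rat_ball q x /\ rat_ball q `<=` U.
Proof.
move=> /nbhs_ballP[e /= e0 xU].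
have [k ke] : exists k, k.+1%:R^-1 < e / 2.
  have [|k] := @ltr_add_invr R 0 (e / 2); first by rewrite divr_gt0.
  by rewrite add0r; exists k.
have k0 : 0 < k.+1%:R^-1 :> R by rewrite invr_gt0.
pose c i := projT1 (cid (rat_in_itvoo (ltr_pwDr k0 (lexx (x ord0 i))))).
have cP i : x 0 i < ratr (c i) < x 0 i + k.+1%:R^-1.
  by rewrite /c; case: cid => q /=; rewrite in_itv.
have bx : rat_ball (\row_i c i, k) x.
  split=> //= i j; rewrite ord1 /ball /= !mxE ltr_distl.
  have /andP[h1 h2] := cP j.
  by rewrite h2 andbT (lt_trans _ h1)// ltrBlDr ltrDl.
exists (\row_i c i, k); split=> // y [_ /= yc]; apply: xU.
rewrite (splitr e); apply: ball_triangle; last first.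
  by split; [rewrite divr_gt0|move=> i j; exact: (le_ball (ltW ke) (yc i j))].
apply/ball_sym; exact: (le_ball (ltW ke)).
Qed.

Lemma open_rat_ball (A : set E) : open A ->
  A = \bigcup_(q in [set q | rat_ball q `<=` A]) rat_ball q.
Proof.
move=> oA; apply/seteqP; split=> x.
  by move=> Ax; have [q [? ?]] := nbhs_rat_ball (open_nbhs_nbhs (conj oA Ax)); exists q.
by case=> q /= qA /qA.
Qed.

Lemma open_measurable_rV (A : set E) : open A -> measurable A.
Proof.
move=> /open_rat_ball ->; rewrite bigcup_mkcond.
apply: countable_bigcupT_measurable => [|q]; first exact: countableP.
by case: ifP => _ //; exact: measurable_ball_rV.
Qed.

Lemma continuous_measurable_rV (f : E -> R) : continuous f -> measurable_fun setT f.
Proof.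
move=> /continuousP cf; apply: (measurability _ (RGenOInfty.measurableE R)) => _ [_ [x ->] <-].
rewrite setTI; apply: open_measurable_rV; apply: cf; exact: interval_open.
Qed.

(** Replaces compactness of a boundary: countably many rational balls
    suffice to cover the set. *)
Lemma negligible_locally (A : set E) :
  (forall x, A x -> exists2 U, nbhs x U & mu.-negligible (A `&` U)) ->
  mu.-negligible A.
Proof.
move=> nA.
pose F q := if `[< mu.-negligible (A `&` rat_ball q) >] then A `&` rat_ball q else set0.
have nF q : mu.-negligible (F q).
  by rewrite /F; case: asboolP => // _; exact: negligible_set0.
pose G k := if @unpickle ('rV[rat]_n * nat)%type k is Some q then F q else set0.
apply: (@negligibleS _ _ _ _ (\bigcup_k G k)).
  move=> x Ax; have [U /nbhs_rat_ball[q [qx qU]] nU] := nA _ Ax.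
  exists (pickle q) => //; rewrite /G pickleK /F; case: asboolP => // -[].
  by apply: negligibleS nU; exact: setIS.
apply: negligible_bigcup => k; rewrite /G; case: unpickle => // .
exact: negligible_set0.
Qed.

End borel.

(** * Bounded sets and translations *)

(** The push-forward as a measure, the measurability proof being an explicit argument. *)
Notation image_measure :=
  measure_function_pushforward__canonical__measure_function_Measure.

Section translation.
Variables (R : realType).

(** Bounded sets are compared with cubes, on which the product structure of the
    measure is visible. *)
Definition cube n (M : R) : set 'rV[R]_n := [set x | forall i, x 0 i \in `[- M, M]].
Arguments cube n M _ : clear implicits.

Lemma measurable_cube n M : measurable (cube n M).
Proof.
rewrite (_ : cube n M =
  \bigcap_(i in [set: 'I_n]) ((fun x : 'rV[R]_n => x ord0 i) @^-1` `[- M, M])).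
  apply: fin_bigcap_measurable => [|i _]; first exact: finite_finset.
  by rewrite -[X in measurable X]setTI; apply: (measurable_coord i) => //;
    exact: measurable_itv.
by apply/seteqP; split => x /= xM i => [_|]; exact: xM.
Qed.

Lemma consV_ord0 n (p : R * 'rV[R]_n) : consV p 0 0 = p.1.
Proof. by have := congr1 (fun q => q.1) (consVK p). Qed.

Lemma consV_lift n (p : R * 'rV[R]_n) j : consV p 0 (lift 0 j) = p.2 0 j.
Proof.
have := congr1 (fun q => q.2) (consVK p) => /= /rowP/(_ j); rewrite mxE.
exact.
Qed.

Lemma lebesgue_rVS n (A : set 'rV[R]_n.+1) :
  lebesgue_rV R n.+1 A = (lebesgue_measure \x lebesgue_rV R n)%E (@consV R n @^-1` A).
Proof. by []. Qed.

Lemma lebesgue_cube_lty n M : (lebesgue_rV R n (cube n M) < +oo)%E.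
Proof.
elim: n => [|n IH].
  by rewrite /= diracE; case: (_ \in _); rewrite ltry.
rewrite lebesgue_rVS (_ : _ @^-1` _ = `[- M, M]%classic `*` cube n M); last first.
  apply/seteqP; split=> -[a v] /=.
    move=> h; split=> /=; first by have := h 0; rewrite consV_ord0.
    by move=> i; have := h (lift 0 i); rewrite consV_lift.
  case=> aM vM i; case: (unliftP 0 i) => [j ->|->].
    by rewrite consV_lift; exact: vM.
  by rewrite consV_ord0.
rewrite product_measure1E//; last exact: measurable_cube.
apply: lte_mul_pinfty => //.
  suff : lebesgue_measure (`[- M, M]%classic : set R) \is a fin_num by [].
  by rewrite lebesgue_measure_itv/=; case: ifP.
Qed.

Lemma coord_le_norm n (x : 'rV[R]_n) i : `|x 0 i| <= `|x|.
Proof.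
by rewrite [leRHS]/Num.norm /= mx_normrE; apply/bigmax_geP; right => /=; exists (0, i).
Qed.

Lemma bounded_cube n (A : set 'rV[R]_n) : bounded_set A -> exists M, A `<=` cube n M.
Proof.
case=> M [_ /(_ (M + 1))]; rewrite ltrDl ltr01 => /(_ isT) AM.
exists (M + 1) => x /AM /= xM i; rewrite in_itv/= -ler_norml.
exact: le_trans (coord_le_norm x i) xM.
Qed.

(** Half-open intervals determine Lebesgue measure on the line. *)
Lemma lebesgue_translate1 (a : R) (A : set R) : measurable A ->
  lebesgue_measure ((fun x => x + a) @^-1` A) = lebesgue_measure A.
Proof.
move=> mA; have mf : measurable_fun [set: measurableTypeR R]
    ((fun x => x + a) : measurableTypeR R -> measurableTypeR R).
  suff : measurable_fun [set: R] (fun x : R => x + a) by [].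
  exact: measurable_funD.
apply/esym.
pose m := image_measure (@lebesgue_measure R) mf.
apply: (@lebesgue_measure_unique R m _ A mA) => X [[x y] _ <-] /=.
rewrite (_ : m _ = lebesgue_measure ((fun x : R => x + a) @^-1` `]x, y]%classic))//.
rewrite (_ : _ @^-1` _ = `]x - a, y - a]%classic); last first.
  by apply/seteqP; split=> z /=; rewrite !in_itv/= ltrBlDr lerBrDr.
by rewrite !lebesgue_measure_itv/= !lte_fin ltrD2r -!EFinD opprB addrA subrK.
Qed.

Lemma measurable_translate n (a : 'rV[R]_n) :
  measurable_fun setT (fun x : 'rV[R]_n => x + a).
Proof.
apply: measurable_fun_rV => i; under eq_fun do rewrite mxE.
by apply: measurable_funD => //; exact: measurable_coord.
Qed.

(** By induction on the dimension: a translate of a product measure of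
    translation-invariant measures agrees with it on rectangles. *)
Lemma lebesgue_translate n (a : 'rV[R]_n) (A : set 'rV[R]_n) : measurable A ->
  lebesgue_rV R n ((fun x => x + a) @^-1` A) = lebesgue_rV R n A.
Proof.
elim: n a A => [|n IH] a A mA.
  by congr (lebesgue_rV R 0 _); apply/seteqP; split=> x /=; rewrite (thinmx0 a) addr0.
rewrite !lebesgue_rVS.
pose t (p : R * 'rV[R]_n) := (p.1 + (tailV a).1, p.2 + (tailV a).2).
have mt0 : measurable_fun [set: R * 'rV[R]_n] t.
  apply: measurable_fun_pair.
    by apply: measurable_funD => //; exact: measurable_fst.
  exact: (measurableT_comp (measurable_translate _) measurable_snd).
have mt : measurable_fun [set: measurableTypeR R * 'rV[R]_n]
    (t : measurableTypeR R * 'rV[R]_n -> measurableTypeR R * 'rV[R]_n) by exact: mt0.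
have mc : measurable (@consV R n @^-1` A).
  by rewrite -[X in measurable X]setTI; exact: measurable_consV.
pose m' := image_measure (lebesgue_measure \x lebesgue_rV R n)%E mt.
rewrite (_ : _ @^-1` _ = t @^-1` (@consV R n @^-1` A)); last first.
  apply/seteqP; split=> p /=; rewrite (_ : consV (t p) = consV p + a)//;
    by rewrite -[RHS]tailVK; congr consV; rewrite /t /tailV !mxE; congr pair;
     [have := consV_ord0 p; rewrite mxE => ->|apply/rowP => j; have := consV_lift p j;
       rewrite !mxE => ->].
apply/esym.
change ((lebesgue_measure \x lebesgue_rV R n)%E (@consV R n @^-1` A) = m' (@consV R n @^-1` A)).
apply: (@product_measure_unique _ _ _ _ _ _ _ m') => // B C mB mC.
rewrite (_ : m' _ = (lebesgue_measure \x lebesgue_rV R n)%E (t @^-1` (B `*` C)))//.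
rewrite (_ : t @^-1` _ = ((fun x => x + (tailV a).1) @^-1` B) `*`
  ((fun x => x + (tailV a).2) @^-1` C))//.
rewrite product_measure1E.
- by congr (_ * _)%E; [exact: lebesgue_translate1|exact: IH].
- by rewrite -[X in measurable X]setTI;
  apply: (_ : measurable_fun [set: R] (fun x : R => x + _)) => //; exact: measurable_funD.
- by rewrite -[X in measurable X]setTI; exact: measurable_translate.
Qed.

Lemma bounded_translate n (a : 'rV[R]_n) (A : set 'rV[R]_n) (M : R) : A `<=` cube n M ->
  (fun x => x + a) @^-1` A `<=` cube n (M + `|a|).
Proof.
move=> AM x /AM /= xaM i; have := xaM i.
have := coord_le_norm a i.
rewrite !in_itv/= mxE -!ler_norml => h1 h2.
by rewrite -[x 0 i](addrK (a 0 i)) (le_trans (ler_normB _ _))// lerD.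
Qed.

End translation.
Arguments cube {R} n M _.

(** * Lipschitz boundaries are null *)

Section boundary.
Variables (R : realType) (n : nat).
Local Notation E := 'rV[R]_n.
Local Notation mu := (lebesgue_rV R n).

Lemma lipschitz_continuous_rV (g : E -> R) k : k.-lipschitz g -> continuous g.
Proof.
move=> gk x; apply/(@cvgrPdist_le _ _ _ _ (nbhs_filter x)) => e e0; near=> y.
apply: (@le_trans _ _ (`|k| * `|x - y|)).
  apply: le_trans (gk (x, y) _) _ => //=; by rewrite ler_wpM2r// ler_norm.
apply: (@le_trans _ _ ((`|k| + 1) * `|x - y|)).
  by rewrite ler_wpM2r// lerDl.
rewrite mulrC -ler_pdivlMr ?ltr_wpDl//.
have : ball x (e / (`|k| + 1)) y.
  by near: y; apply: nbhsx_ballx; rewrite divr_gt0// ltr_wpDl.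
by rewrite -ball_normE /= => /ltW.
Unshelve. all: by end_near. Qed.

Lemma dotDl (x y z : E) : dot (x + y) z = dot x z + dot y z.
Proof. by rewrite -big_split; apply: eq_bigr => i _ /=; rewrite mxE mulrDl. Qed.

Lemma dotZl (t : R) (x z : E) : dot (t *: x) z = t * dot x z.
Proof. by rewrite mulr_sumr; apply: eq_bigr => i _; rewrite mxE mulrA. Qed.

Lemma measurable_dotr (e : E) : measurable_fun setT (fun x => dot x e).
Proof.
apply: measurable_sum => i; apply: measurable_funM => //; exact: measurable_coord.
Qed.

(** Moving the graph by 1/(j+1) along e, for j = 0, 1, ..., gives pairwise
    disjoint sets of equal measure inside one bounded set; so this measure is 0. *)
Lemma lipschitz_graph_null (e : E) (g : E -> R) k M :
  dot e e = 1 -> (forall x t, g (x + t *: e) = g x) -> k.-lipschitz g ->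
  mu.-negligible ([set x | g x = dot x e] `&` cube n M).
Proof.
move=> e1 gt gk; have cg := lipschitz_continuous_rV gk.
set S := _ `&` _.
have mS : measurable S.
  apply: measurableI; last exact: measurable_cube.
  rewrite (_ : [set x | _] = (fun x => g x - dot x e) @^-1` [set 0]).
    rewrite -[X in measurable X]setTI.
    have : measurable_fun setT (fun x => g x - dot x e).
      by apply: measurable_funB; [exact: continuous_measurable_rV|exact: measurable_dotr].
    by apply => //; exact: measurable_set1.
  apply/seteqP; split=> x /=; first by move->; rewrite subrr.
  by move/eqP; rewrite subr_eq0 => /eqP.
pose St j := (fun x => x + j.+1%:R^-1 *: e) @^-1` S.
have mSt j : measurable (St j).
  by rewrite -[X in measurable X]setTI; exact: measurable_translate.
have tSt : trivIset setT St.
  apply/trivIsetP => i j _ _ ij; rewrite -subset0 => x [[/= + _] [/= + _]].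
  rewrite !gt !dotDl !dotZl e1 !mulr1 => -> /addrI/invr_inj/eqP.
  by rewrite eqr_nat eqSS (negbTE ij).
have sSt j : St j `<=` cube n (M + `|e|).
  have : S `<=` cube n M by move=> x [].
  move=> /(@bounded_translate R n (j.+1%:R^-1 *: e)) /subset_trans; apply => x xM i.
  have := xM i; rewrite !in_itv/= -!ler_norml => /le_trans; apply.
  rewrite lerD2l normrZ ler_piMl// ger0_norm ?invr_ge0//.
  by rewrite invf_le1 ?ltr0n// ler1n.
have muS : (mu S < +oo)%E.
  apply: le_lt_trans (lebesgue_cube_lty n M).
  by apply: le_measure; rewrite ?inE//; [exact: measurable_cube|move=> x []].
have muC := @lebesgue_cube_lty R n (M + `|e|).
have H N : N%:R * fine (mu S) <= fine (mu (cube n (M + `|e|))).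
  have : (mu (\big[setU/set0]_(i < N) St i) <= mu (cube n (M + `|e|)))%E.
    apply: le_measure; rewrite ?inE; [exact: bigsetU_measurable|exact: measurable_cube|].
    by rewrite -bigcup_mkord; apply: bigcup_sub => i _; exact: sSt.
  rewrite measure_bigsetU// (eq_bigr (fun=> (fine (mu S))%:E)); last first.
    by move=> i _; rewrite fineK ?ge0_fin_numE//; exact: lebesgue_translate.
  rewrite sumEFin -[mu (cube _ _)]fineK ?ge0_fin_numE// lee_fin.
  by rewrite sumr_const card_ord mulr_natl.
exists S; split => //.
apply/eqP; rewrite -[mu S]fineK ?ge0_fin_numE// eqe; apply/negP => /negP S0.
have S0' : 0 < fine (mu S) by rewrite lt_neqAle eq_sym S0 fine_ge0.
have := H (Num.Def.archi_bound (fine (mu (cube n (M + `|e|))) / fine (mu S))).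
rewrite leNgt -ltr_pdivrMr// archi_boundP// divr_ge0// fine_ge0//.
Qed.

(** Near a boundary point the set is a strict epigraph, so boundary points
    there lie on the graph: below it they would be outside of the closure, above it
    inside of the open set. *)
Lemma lipschitz_boundary_null (A : set E) : open A -> bounded_set A ->
  lipschitz_boundary A -> mu.-negligible (closure A `\` A).
Proof.
move=> oA /bounded_cube[M AM] lA; apply: negligible_locally => x0 x0A.
have [e [g [k [r [e1 gt gk r0 Ag]]]]] := lA _ x0A.
exists (ball x0 r); first exact: nbhsx_ballx.
have cg := lipschitz_continuous_rV gk.
have cd : continuous (fun x => dot x e).
  apply: (@continuous_big R 'I_n +%R 0 predT) => [|i _ x]; first exact: add_continuous.
  by apply: continuousM; [exact: coord_continuous|exact: cst_continuous].
have clM : closure A `<=` cube n (M + 1).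
  move=> x /(_ _ (nbhsx_ballx x 1 ltr01)) [y [/AM yM [_ xy]]] i.
  have := yM i; have := xy 0 i; rewrite !in_itv/= -!ler_norml /ball/= => h1 h2.
  by rewrite -[x 0 i](subrK (y 0 i)) addrC (le_trans (ler_normD _ _))// lerD// ltW.
apply: negligibleS (lipschitz_graph_null (M + 1) e1 gt gk) => x [[clx nAx] bx].
split; last exact: clM.
apply/eqP; rewrite eq_le; apply/andP; split; rewrite leNgt; apply/negP => h.
- have := clx (ball x0 r `&` [set y | dot y e < g y]) => -[].
    apply: filterI; first by apply: open_nbhs_nbhs; split=> //; exact: ball_open.
    have ch : continuous (fun y => g y - dot y e).
      by move=> y; apply: (@continuousB R R^o _ g (fun z => dot z e) y); [exact: cg|exact: cd].
    have := open_comp (fun y _ => ch y) (@open_gt R 0).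
    move=> /(_ x) /=; rewrite subr_gt0 => /(_ h).
    by apply: filterS => y /=; rewrite subr_gt0.
  by move=> y [Ay [yb /lt_trans hy]]; have /(Ag y yb) /hy := Ay; rewrite ltxx.
- by apply: nAx; apply/Ag.
Qed.

End boundary.

(** * Orthogonal projection in complete spaces with a semi-inner product *)

Section projection.
Variables (R : realType) (W : lmodType R).
Implicit Types (K S : set W) (B : W -> W -> R).

(** A positive semidefinite symmetric form on a linear subspace K of an ambient
    module. The form need not be defined sensibly outside of K, which is how integrals
    of functions that are not square integrable are kept out, and functions equal almost
    everywhere are not identified. *)
Record prehilbert K B : Prop := Prehilbert {
  prehilbert0 : K 0;
  prehilbert_lin : forall a x y, K x -> K y -> K (a *: x + y);
  formC : forall x y, K x -> K y -> B x y = B y x;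
  form_linl : forall a x y z, K x -> K y -> K z -> B (a *: x + y) z = a * B x z + B y z;
  form_ge0 : forall x, K x -> 0 <= B x x }.

(** Completeness for the seminorm of the form; limits are not unique. *)
Definition form_complete K B :=
  forall u : nat -> W, (forall k, K (u k)) ->
  (forall e, 0 < e -> exists N, forall i j, (N <= i)%N -> (N <= j)%N ->
     B (u i - u j) (u i - u j) < e) ->
  exists2 l, K l & forall e, 0 < e -> exists N, forall i, (N <= i)%N ->
     B (u i - l) (u i - l) < e.

Lemma discriminant_le0 (a b c : R) : 0 <= a ->
  (forall t, 0 <= a * t ^+ 2 + 2 * b * t + c) -> b ^+ 2 <= a * c.
Proof.
rewrite le_eqVlt => /predU1P[<-|a0] H; last first.
  have := H (- b / a); rewrite (_ : _ + _ = c - b ^+ 2 / a); last by field; rewrite gt_eqF.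
  by rewrite subr_ge0 ler_pdivrMr// mulrC.
have [->|b0] := eqVneq b 0; first by rewrite mul0r expr0n.
have := H (- (c + 1) / (2 * b)).
by rewrite (_ : _ + _ = -1) ?oppr_ge0 ?ler10//; field.
Qed.

Section theory.
Variables (K : set W) (B : W -> W -> R).
Hypothesis H : prehilbert K B.

Lemma prehilbertD x y : K x -> K y -> K (x + y).
Proof. by move=> kx ky; rewrite -[x]scale1r; exact: (prehilbert_lin H). Qed.
Lemma prehilbertZ a x : K x -> K (a *: x).
Proof. by move=> kx; rewrite -[_ *: _]addr0; apply: (prehilbert_lin H) => //;
  exact: (prehilbert0 H). Qed.
Lemma prehilbertN x : K x -> K (- x).
Proof. by move=> kx; rewrite -scaleN1r; exact: prehilbertZ. Qed.
Lemma prehilbertB x y : K x -> K y -> K (x - y).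
Proof. by move=> kx ky; apply: prehilbertD => //; exact: prehilbertN. Qed.

Lemma formDl x y z : K x -> K y -> K z -> B (x + y) z = B x z + B y z.
Proof. by move=> kx ky kz; rewrite -{1}[x]scale1r (form_linl H)// mul1r. Qed.
Lemma form0l z : K z -> B 0 z = 0.
Proof. by move=> kz; have := formDl (prehilbert0 H) (prehilbert0 H) kz;
  rewrite addr0 -[LHS]addr0 => /addrI. Qed.
Lemma formZl a x z : K x -> K z -> B (a *: x) z = a * B x z.
Proof. by move=> kx kz; rewrite -[_ *: _]addr0 (form_linl H) ?form0l ?addr0//;
  exact: (prehilbert0 H). Qed.
Lemma formNl x z : K x -> K z -> B (- x) z = - B x z.
Proof. by move=> kx kz; rewrite -scaleN1r formZl// mulN1r. Qed.
Lemma formBl x y z : K x -> K y -> K z -> B (x - y) z = B x z - B y z.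
Proof. by move=> kx ky kz; rewrite formDl ?formNl//; exact: prehilbertN. Qed.
Lemma formDr x y z : K x -> K y -> K z -> B z (x + y) = B z x + B z y.
Proof. by move=> kx ky kz; rewrite !(formC H kz) ?formDl//; exact: prehilbertD. Qed.
Lemma formZr a x z : K x -> K z -> B z (a *: x) = a * B z x.
Proof. by move=> kx kz; rewrite !(formC H kz) ?formZl//; exact: prehilbertZ. Qed.
Lemma formBr x y z : K x -> K y -> K z -> B z (x - y) = B z x - B z y.
Proof. by move=> kx ky kz; rewrite !(formC H kz) ?formBl//; exact: prehilbertB. Qed.

Lemma form_expand a x y : K x -> K y ->
  B (a *: x + y) (a *: x + y) = B x x * a ^+ 2 + 2 * B x y * a + B y y.
Proof.
move=> kx ky; have ka := prehilbertZ a kx.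
rewrite formDl ?formDr ?formZl ?formZr//; try exact: prehilbertD.
by rewrite (formC H ky kx); ring.
Qed.

Lemma form_cauchy_schwarz x y : K x -> K y -> B x y ^+ 2 <= B x x * B y y.
Proof.
move=> kx ky; apply: discriminant_le0 => [|t]; first exact: (form_ge0 H).
rewrite -form_expand//.
by apply: (form_ge0 H); exact: (prehilbert_lin H).
Qed.

Lemma form_cauchy_schwarz_sqrt x y : K x -> K y ->
  `|B x y| <= Num.sqrt (B x x) * Num.sqrt (B y y).
Proof.
move=> kx ky; rewrite -sqrtrM ?(form_ge0 H)// -sqrtr_sqr ler_wsqrtr//.
exact: form_cauchy_schwarz.
Qed.

Lemma form_triangle x y : K x -> K y ->
  Num.sqrt (B (x + y) (x + y)) <= Num.sqrt (B x x) + Num.sqrt (B y y).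
Proof.
move=> kx ky; rewrite -[leRHS]ger0_norm ?addr_ge0 ?sqrtr_ge0// -sqrtr_sqr ler_wsqrtr//.
rewrite -{1 2}[x]scale1r form_expand// sqrrD !sqr_sqrtr ?(form_ge0 H)//.
have := form_cauchy_schwarz_sqrt kx ky; have := ler_norm (B x y); lra.
Qed.

(** A minimizing sequence for the distance from y to S is a Cauchy sequence by
    the parallelogram identity. At its k-th term the distance is within 1/(k+1) of
    the infimum, so a quadratic polynomial in t is nonnegative and the square of the
    form at (y - u k, x) is at most 1/(k+1) times that of x; this passes to the limit. *)
Lemma form_projection S y : form_complete K B ->
  S `<=` K -> S 0 -> (forall a x y, S x -> S y -> S (a *: x + y)) ->
  (forall v, K v -> (forall e, 0 < e -> exists2 s, S s & B (v - s) (v - s) < e) -> S v) ->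
  K y -> exists2 z, S z & forall x, S x -> B (y - z) x = 0.
Proof.
move=> cK SK S0 Slin Scl Ky.
pose D := [set B (y - s) (y - s) | s in S].
have D0 : has_inf D.
  split; first by exists (B (y - 0) (y - 0)), 0.
  by exists 0 => _ [s Ss <-]; apply: (form_ge0 H); apply: prehilbertB => //; exact: SK.
have Dle s : S s -> inf D <= B (y - s) (y - s).
  by move=> Ss; apply: (inf_lbound (proj2 D0)); exists s.
have /choice[u uP] k : exists s, S s /\ B (y - s) (y - s) < inf D + k.+1%:R^-1.
  have k0 : 0 < k.+1%:R^-1 :> R by rewrite invr_gt0.
  by have [_ [s Ss <-] sk] := inf_adherent k0 D0; exists s.
have Ku k : K (u k) by apply: SK; exact: (uP k).1.
have Kyu k : K (y - u k) by exact: prehilbertB.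
have par i j : B (u i - u j) (u i - u j) <= 2 * (i.+1%:R^-1 + j.+1%:R^-1).
  have Sm : S (2^-1 *: u i + 2^-1 *: u j).
    apply: (Slin); first exact: (uP i).1.
    by rewrite -[_ *: _]addr0; apply: (Slin) => //; exact: (uP j).1.
  have := Dle _ Sm.
  have -> : y - (2^-1 *: u i + 2^-1 *: u j) = 2^-1 *: (y - u i) + 2^-1 *: (y - u j).
    rewrite !scalerBr addrACA -scalerDl -opprD (_ : 2^-1 + 2^-1 = 1) ?scale1r//; lra.
  have -> : u i - u j = (y - u j) - (y - u i).
    by rewrite opprB [RHS]addrC addrA subrK.
  move: (uP i).2 (uP j).2 (Kyu i) (Kyu j).
  move: (y - u i) (y - u j) => p q pi qj Kp Kq.
  rewrite form_expand//; last exact: prehilbertZ.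
  rewrite formZl ?formZr//; last exact: prehilbertZ.
  rewrite formBl ?formBr//; try exact: prehilbertB.
  rewrite (formC H Kq Kp) => {Kp Kq}.
  move: (inf D) (B p p) (B p q) (B q q) i.+1%:R^-1 j.+1%:R^-1 pi qj => m a b c ri rj h1 h2 h3.
  have : m <= (a + 2 * b + c) / 4 by apply: le_trans h3 _; rewrite le_eqVlt; apply/orP;
    left; apply/eqP; field.
  lra.
have [|l Kl ul] := cK u Ku.
  move=> e e0; have [|N] := @ltr_add_invr R 0 (e / 4); first by rewrite divr_gt0.
  rewrite add0r => Ne; exists N => i j Ni Nj; apply: le_lt_trans (par i j) _.
  have Hi k : (N <= k)%N -> k.+1%:R^-1 <= N.+1%:R^-1 :> R.
    by move=> Nk; rewrite lef_pV2 ?posrE// ler_nat.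
  have := Hi _ Ni; have := Hi _ Nj.
  move: i.+1%:R^-1 j.+1%:R^-1 N.+1%:R^-1 Ne => a b c; lra.
have Sl : S l.
  apply: Scl => // e /ul[N /(_ N (leqnn _)) Ne]; exists (u N); first exact: (uP N).1.
  suff -> : l - u N = - (u N - l).
    by rewrite formNl ?(formC H _ (prehilbertN _)) ?formNl ?opprK//;
      do ?[apply: prehilbertN]; apply: prehilbertB.
  by rewrite opprB.
exists l => // x Sx; have Kx := SK _ Sx.
have orth k : B (y - u k) x ^+ 2 <= B x x * k.+1%:R^-1.
  apply: discriminant_le0 => [|t]; first exact: (form_ge0 H).
  have : inf D <= B (y - (- t *: x + u k)) (y - (- t *: x + u k)).
    by apply: Dle; apply: (Slin) => //; exact: (uP k).1.
  have -> : y - (- t *: x + u k) = t *: x + (y - u k).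
    by rewrite opprD scaleNr opprK addrCA addrA.
  rewrite form_expand// (formC H Kx)//; have := (uP k).2.
  move: (inf D) k.+1%:R^-1 => m r; lra.
apply/eqP; rewrite -sqrf_eq0 eq_le sqr_ge0 andbT; apply/ler_addgt0Pr => e e0; rewrite add0r.
have x0 := form_ge0 H Kx.
pose c := e / (4 * (B x x + 1)).
have c0 : 0 < c by rewrite divr_gt0// mulr_gt0// ltr_wpDl.
have [N1 N1P] := ul _ c0.
have [|N2] := @ltr_add_invr R 0 c => //; rewrite add0r => N2P.
pose N := maxn N1 N2.
have h1 : B (u N - l) (u N - l) < c by apply: N1P; exact: leq_maxl.
have h2 : N.+1%:R^-1 < c.
  by apply: le_lt_trans N2P; rewrite lef_pV2 ?posrE// ler_nat ltnS leq_maxr.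
have Kul : K (u N - l) by exact: prehilbertB.
have -> : y - l = (y - u N) + (u N - l) by rewrite addrA subrK.
rewrite formDl//.
have := orth N; have := form_cauchy_schwarz Kul Kx.
have -> : e = 4 * (B x x + 1) * c.
  by rewrite /c; field; rewrite gt_eqF// ltr_wpDl.
move: h1 h2 c0 x0 (form_ge0 H Kul) => {N1P N2P}; clearbody c.
move: (B (y - u N) x) (B (u N - l) x) (B x x) (B (u N - l) (u N - l)) N.+1%:R^-1 c.
move=> p q X U V c' Uc Vc c0 X0 U0 hq hp.
have : U * X <= c' * X by rewrite ler_wpM2r// ltW.
have : X * V <= X * c' by rewrite ler_wpM2l// ltW.
have := sqr_ge0 (p - q); nra.
Qed.

End theory.
End projection.

(** * Completeness of L_2 *)

Section L2.
Variables (R : realType) (n : nat).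
Local Notation E := 'rV[R]_n.
Local Notation mu := (lebesgue_rV R n).
Variable omega : set E.
Hypothesis mo : measurable omega.
Implicit Types f g h : E -> R.

Lemma L2_measurable f : L2 omega f -> measurable_fun omega f.
Proof. by case. Qed.

Lemma L2_integrable_sqr f : L2 omega f -> mu.-integrable omega (EFin \o (fun x => f x ^+ 2)).
Proof.
case=> mf foo; apply/integrableP; split.
  by apply/measurable_EFinP; exact: measurable_funX.
by under eq_integral do rewrite /= ger0_norm ?sqr_ge0//.
Qed.

Lemma L2_integrableM f g : L2 omega f -> L2 omega g ->
  mu.-integrable omega (EFin \o (fun x => f x * g x)).
Proof.
move=> Lf Lg; have := integrableD mo (L2_integrable_sqr Lf) (L2_integrable_sqr Lg).
apply: le_integrable => //.
  by apply/measurable_EFinP; apply: measurable_funM; exact: L2_measurable.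
move=> x _ /=; rewrite lee_fin normrM [leRHS]ger0_norm ?addr_ge0 ?sqr_ge0//.
have := sqr_ge0 (`|f x| - `|g x|);
  rewrite -(real_normK (num_real (f x))) -(real_normK (num_real (g x))).
by have := normr_ge0 (f x); have := normr_ge0 (g x); nra.
Qed.

Lemma L20 : L2 omega 0.
Proof.
split; first exact: measurable_cst.
by under eq_integral do rewrite /= expr0n/=; rewrite integral0.
Qed.

(** (a f + g)^2 <= 2 a^2 f^2 + 2 g^2. *)
Lemma L2_lin a f g : L2 omega f -> L2 omega g -> L2 omega (a *: f + g).
Proof.
move=> Lf Lg; have mfg : measurable_fun omega (a *: f + g).
  by apply: measurable_funD; [apply: measurable_funM => //;
    exact: L2_measurable|exact: L2_measurable].
split => //.
have I : mu.-integrable omega (EFin \o (fun x => 2 * a ^+ 2 * f x ^+ 2 + 2 * g x ^+ 2)).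
  exact: (integrableD mo (integrableZl mo (2 * a ^+ 2) (L2_integrable_sqr Lf))
                         (integrableZl mo 2 (L2_integrable_sqr Lg))).
have /integrableP[_] : mu.-integrable omega (EFin \o (fun x => (a *: f + g) x ^+ 2)).
  apply: le_integrable I => //; first by apply/measurable_EFinP; exact: measurable_funX.
  move=> x _ /=; rewrite lee_fin [leLHS]ger0_norm ?sqr_ge0// (le_trans _ (ler_norm _))//.
  rewrite (_ : (a *: f + g) x = a * f x + g x)//.
  have := sqr_ge0 (a * f x - g x); nra.
by under eq_integral do rewrite /= ger0_norm ?sqr_ge0//.
Qed.

Lemma L2_prehilbert : prehilbert (L2 omega) (ip omega).
Proof.
split; [exact: L20|exact: L2_lin|..].
- by move=> f g _ _; apply: eq_Rintegral => x _; rewrite mulrC.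
- move=> a f g h Lf Lg Lh; rewrite /ip.
  rewrite -RintegralZl ?L2_integrableM// -RintegralD//; last exact: L2_integrableM.
    by apply: eq_Rintegral => x _; rewrite mulrDl mulrA.
  exact: (integrableZl mo a (L2_integrableM Lf Lh)).
- by move=> f Lf; apply: Rintegral_ge0 => x _; rewrite -expr2 sqr_ge0.
Qed.

Lemma ip_EFin f g : L2 omega f -> L2 omega g ->
  (ip omega f g)%:E = (\int[mu]_(x in omega) (f x * g x)%:E)%E.
Proof.
move=> Lf Lg; rewrite fineK//; exact: integrable_fin_num (L2_integrableM Lf Lg).
Qed.

(** The increments are dominated by a geometric sequence of ratio 1/2. *)
Lemma cvg_summable_increments (v : R^nat) (C : R) :
  (forall k, 4 ^+ k * (v k.+1 - v k) ^+ 2 <= C) -> cvgn v.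
Proof.
move=> H; have C0 : 0 <= C by apply: le_trans (H 0%N); rewrite mul1r sqr_ge0.
pose w k := v k.+1 - v k.
have bw k : `|w k| <= Num.sqrt C * (2^-1) ^+ k.
  rewrite -[leLHS]sqrtr_sqr exprVn ler_pdivlMr ?exprn_gt0//.
  have e4 : 4 ^+ k = (2 ^+ k) ^+ 2 :> R by rewrite -exprM mulnC exprM; congr (_ ^+ _); ring.
  rewrite (_ : 2 ^+ k = Num.sqrt (4 ^+ k)); last by rewrite e4 sqrtr_sqr ger0_norm ?exprn_ge0.
  by rewrite -sqrtrM ?sqr_ge0// ler_wsqrtr// mulrC; exact: H.
have cw : cvgn (series w).
  apply: normed_cvg; apply: (@series_le_cvg _ _ (geometric (Num.sqrt C) 2^-1)) => //.
  - by move=> k /=; exact: normr_ge0.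
  - by move=> k; rewrite geometric_ge0 ?sqrtr_ge0.
  - apply: is_cvg_geometric_series; rewrite ger0_norm; lra.
have -> : v = (fun k => v 0%N + series w k).
  by apply/funext => k; rewrite /series /= telescope_sumr// addrC subrK.
by apply: is_cvgD => //; exact: is_cvg_cst.
Qed.

Lemma limn_einf_le (u : (\bar R)^nat) (M : \bar R) :
  (forall k, (u k <= M)%E) -> (limn_einf u <= M)%E.
Proof.
move=> uM; rewrite limn_einf_lim; apply: lime_le; first exact: is_cvg_einfs.
apply: nearW => k; apply: le_trans (uM k); apply: ereal_inf_lbound.
by exists k => /=.
Qed.

(** Along a subsequence whose k-th increment has square norm below 8^-k, the
    sum of 4^k times the squared increments has a finite integral, hence is finite
    almost everywhere, and the subsequence converges there. Fatou's lemma turns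
    the pointwise limit into a limit in norm. *)
Lemma L2_complete : form_complete (L2 omega) (ip omega).
Proof.
move=> u Lu uC.
have ge8 k : 0 < 8 ^- k :> R by rewrite invr_gt0 exprn_gt0.
have /choice[N NP] k := uC _ (ge8 k).
(* the indices M k increase strictly, hence exceed any given bound *)
pose M k := (\sum_(j < k.+1) (N j).+1)%N.
have MN k : (N k <= M k)%N by rewrite /M big_ord_recr/= (leq_trans (leqnSn _))// leq_addl.
have MS k : (M k <= M k.+1)%N by rewrite /M [leqRHS]big_ord_recr/= leq_addr.
pose g k := u (M k).
have Lg k : L2 omega (g k) by exact: Lu.
have Lgg k : L2 omega (g k.+1 - g k) by exact: (prehilbertB L2_prehilbert).
have gg k : ip omega (g k.+1 - g k) (g k.+1 - g k) < 8 ^- k.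
  by apply: NP => //; rewrite (leq_trans (MN k)).
pose h k x := (4 ^+ k * (g k.+1 x - g k x) ^+ 2)%:E.
have h0 k x : omega x -> (0 <= h k x)%E by move=> _; rewrite lee_fin; apply: mulr_ge0;
  [exact: exprn_ge0|exact: sqr_ge0].
have ih k : mu.-integrable omega (h k).
  exact: (integrableZl mo (4 ^+ k) (L2_integrable_sqr (Lgg k))).
have mh k : measurable_fun omega (h k) by exact: (measurable_int mu).
have inth k : (\int[mu]_(x in omega) h k x <= (2^-1 ^+ k)%:E)%E.
  rewrite /h; under eq_integral do rewrite EFinM.
  rewrite integralZl//; last exact: (L2_integrable_sqr (Lgg k)).
  rewrite (_ : (\int[mu]_(x in omega) _)%E = (ip omega (g k.+1 - g k) (g k.+1 - g k))%:E);
    last first.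
    by rewrite ip_EFin//; apply: eq_integral => x _; rewrite expr2.
  rewrite -EFinM lee_fin (_ : 2^-1 ^+ k = 4 ^+ k * 8 ^- k).
    by rewrite ler_pM2l ?exprn_gt0// ltW.
  by rewrite -exprVn -exprMn; congr (_ ^+ _); field.
pose H x := (\sum_(0 <= k <oo) h k x)%E.
have mH : measurable_fun omega H.
  by apply: ge0_emeasurable_sum => // k x xo _; exact: h0.
have H0 x : omega x -> (0 <= H x)%E by move=> xo; apply: nneseries_ge0 => k _ _; exact: h0.
have Hoo : (\int[mu]_(x in omega) H x < +oo)%E.
  rewrite integral_nneseries//.
  apply: (@le_lt_trans _ _ (\sum_(0 <= k <oo) (2^-1 ^+ k)%:E)%E).
    by apply: lee_nneseries => // k _ _; apply: integral_ge0 => x; exact: h0.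
  apply: (@le_lt_trans _ _ 2%:E); last exact: ltry.
  apply: lime_le; first by apply: is_cvg_nneseries => k _ _; rewrite lee_fin exprn_ge0.
  apply: nearW => k; rewrite sumEFin lee_fin.
  have -> : \sum_(0 <= i < k) 2^-1 ^+ i = 2 - 2 * 2^-1 ^+ k :> R.
    elim: k => [|k IH]; first by rewrite big_geq// expr0; lra.
    by rewrite big_nat_recr//= IH exprS; lra.
  by rewrite gerBl mulr_ge0// exprn_ge0.
have iH : mu.-integrable omega H.
  apply/integrableP; split => //.
  by under eq_integral => x /[!inE] xo do rewrite gee0_abs ?H0//.
pose A := omega `&` [set x | H x < +oo]%E.
have mA : measurable A by exact: emeasurable_fun_infty_o.
have cvgA x : A x -> cvgn (g ^~ x).
  move=> [xo Hx]; apply: (@cvg_summable_increments _ (fine (H x))) => k.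
  rewrite -lee_fin fineK; last by rewrite ge0_fin_numE// H0.
  apply: le_trans (nneseries_lim_ge k.+1 _) => [|j _ _]; last exact: h0.
  by rewrite big_nat_recr//= leeDr// sume_ge0// => j _; exact: h0.
(* cutting off outside of A makes the sequence converge everywhere *)
pose g' k := g k \_ A.
pose l x := limn (g' ^~ x).
have g'l x : g' ^~ x @ \oo --> l x.
  have [xA|xA] := boolP (x \in A).
    rewrite /l (_ : g' ^~ x = g ^~ x); first exact/cvgA/set_mem.
    by apply/funext => k; rewrite /g' /restrict xA.
  rewrite /l (_ : g' ^~ x = cst 0); first exact: is_cvg_cst.
  by apply/funext => k; rewrite /g' /restrict (negbTE xA).
have mg' k : measurable_fun omega (g' k).
  apply/(measurable_restrict _ mA mo).
  have Ao : A `<=` omega by move=> x [].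
  by rewrite setIidr//; exact: measurable_funS mo Ao (L2_measurable (Lg k)).
have ml : measurable_fun omega l by apply: (measurable_fun_cvg mg') => x _; exact: g'l.
have aeA : {ae mu, forall x, omega x -> A x}.
  apply: filterS (integrable_ae mo iH) => x Hx xo; split => //=.
  by rewrite -ge0_fin_numE ?H0//; exact: Hx.
have key J p e : L2 omega p ->
    (forall j, (J <= j)%N -> ip omega (p - g j) (p - g j) <= e) ->
    (\int[mu]_(x in omega) ((p x - l x) ^+ 2)%:E <= e%:E)%E.
  move=> Lp pge.
  have mpg' j : measurable_fun omega (fun x => ((p x - g' (j + J)%N x) ^+ 2)%:E).
    by apply/measurable_EFinP; apply: measurable_funX; apply: measurable_funB => //;
      exact: L2_measurable.
  have := fatou mu mo mpg' (fun j x _ => sqr_ge0 _).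
  rewrite (eq_integral (fun x => ((p x - l x) ^+ 2)%:E)) => [/le_trans|x _]; last first.
    have lx : (fun j => p x - g' (j + J)%N x) @ \oo --> p x - l x.
      apply: cvgB; first exact: cvg_cst.
      by rewrite (cvg_shiftn J (fun j => g' j x)); exact: g'l.
    have lx2 : (fun j => (p x - g' (j + J)%N x) ^+ 2) @ \oo --> (p x - l x) ^+ 2.
      by rewrite expr2; under eq_fun do rewrite expr2; exact: cvgM.
    apply: (cvg_limn_einf_sup _).1; apply/cvg_EFin; first exact: nearW.
    exact: lx2.
  apply; apply: limn_einf_le => j.
  have Lpg : L2 omega (p - g (j + J)%N) by exact: (prehilbertB L2_prehilbert).
  rewrite (ge0_ae_eq_integral (g := fun x => ((p - g (j + J)%N) x * (p - g (j + J)%N) x)%:E))//.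
  - by rewrite -ip_EFin// lee_fin pge// leq_addl.
  - by apply/measurable_EFinP; apply: measurable_funM; exact: L2_measurable.
  - by move=> x _; rewrite lee_fin sqr_ge0.
  - by move=> x _; rewrite lee_fin -expr2 sqr_ge0.
  - by apply: filterS aeA => x Ax /Ax xA; rewrite /g' /restrict mem_set//.
have key2 p e : L2 omega p -> (exists J, forall j, (J <= j)%N ->
  ip omega (p - g j) (p - g j) <= e) ->
    L2 omega (p - l) /\ ip omega (p - l) (p - l) <= e.
  move=> Lp [J /(key _ _ _ Lp) ple].
  have Lpl : L2 omega (p - l).
    split; first by apply: measurable_funB => //; exact: L2_measurable.
    exact: le_lt_trans ple (ltry _).
  by split=> //; rewrite -lee_fin ip_EFin//.
have uj e : 0 < e -> exists K, forall k, (K <= k)%N -> exists J, forall j, (J <= j)%N ->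
    ip omega (u k - g j) (u k - g j) <= e.
  move=> /uC[K KP]; exists K => k Kk; exists K => j Kj; apply: ltW; apply: KP => //.
  apply: leq_trans Kj _; apply: (@leq_trans (\sum_(i < j.+1) 1)%N).
    by rewrite sum1_card card_ord.
  exact: leq_sum.
exists l.
  have [K KP] := uj 1 ltr01; have [Lul _] := key2 _ _ (Lu K) (KP K (leqnn _)).
  by have -> : l = u K - (u K - l);
    [rewrite opprB addrC subrK|exact: (prehilbertB L2_prehilbert)].
move=> e e0; have e2 : 0 < e / 2 by rewrite divr_gt0.
have [K KP] := uj _ e2; exists K => k Kk.
have [_ /le_lt_trans] := key2 _ _ (Lu k) (KP k Kk); apply; lra.
Qed.

End L2.

(** * Products of L_2 spaces *)

Section product_form.
Variables (R : realType) (W1 W2 : lmodType R).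
Variables (K1 : set W1) (B1 : W1 -> W1 -> R) (K2 : set W2) (B2 : W2 -> W2 -> R).
Variables (a1 a2 : R).
Hypotheses (a1_gt0 : 0 < a1) (a2_gt0 : 0 < a2).

(** The weights carry the scaling by d of the norms of H^1 and H(div). *)
Definition pair_form (v w : W1 * W2) : R := a1 * B1 v.1 w.1 + a2 * B2 v.2 w.2.

Lemma pair_prehilbert : prehilbert K1 B1 -> prehilbert K2 B2 ->
  prehilbert (K1 `*` K2) pair_form.
Proof.
move=> H1 H2; split.
- by split; [exact: (prehilbert0 H1)|exact: (prehilbert0 H2)].
- by move=> a x y [? ?] [? ?]; split; [exact: (prehilbert_lin H1)|exact: (prehilbert_lin H2)].
- by move=> x y [? ?] [? ?]; rewrite /pair_form (formC H1)// (formC H2).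
- move=> a x y z [? ?] [? ?] [? ?];
  rewrite /pair_form /= (form_linl H1)// (form_linl H2)//; ring.
- by move=> x [? ?]; rewrite addr_ge0// mulr_ge0// ?(form_ge0 H1)// ?(form_ge0 H2)// ltW.
Qed.

Lemma pair_complete : prehilbert K1 B1 -> prehilbert K2 B2 ->
  form_complete K1 B1 -> form_complete K2 B2 -> form_complete (K1 `*` K2) pair_form.
Proof.
move=> H1 H2 C1 C2 u Ku uC.
have K1u k l : 0 <= B1 ((u k).1 - (u l).1) ((u k).1 - (u l).1).
  by apply: (form_ge0 H1); apply: (prehilbertB H1); [exact: (Ku k).1|exact: (Ku l).1].
have K2u k l : 0 <= B2 ((u k).2 - (u l).2) ((u k).2 - (u l).2).
  by apply: (form_ge0 H2); apply: (prehilbertB H2); [exact: (Ku k).2|exact: (Ku l).2].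
have [k|e e0|l1 Kl1 ul1] := C1 (fun k => (u k).1); first exact: (Ku k).1.
  have [N NP] := uC _ (mulr_gt0 a1_gt0 e0); exists N => i j Ni Nj.
  rewrite -(ltr_pM2l a1_gt0); apply: le_lt_trans (NP i j Ni Nj).
  by rewrite /pair_form /= lerDl mulr_ge0// ltW.
have [k|e e0|l2 Kl2 ul2] := C2 (fun k => (u k).2); first exact: (Ku k).2.
  have [N NP] := uC _ (mulr_gt0 a2_gt0 e0); exists N => i j Ni Nj.
  rewrite -(ltr_pM2l a2_gt0); apply: le_lt_trans (NP i j Ni Nj).
  by rewrite /pair_form /= lerDr mulr_ge0// ltW.
exists (l1, l2) => // e e0.
have [N1 N1P] := ul1 _ (divr_gt0 (divr_gt0 e0 (ltr0n _ 2)) a1_gt0).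
have [N2 N2P] := ul2 _ (divr_gt0 (divr_gt0 e0 (ltr0n _ 2)) a2_gt0).
exists (maxn N1 N2) => i; rewrite geq_max => /andP[/N1P + /N2P].
by rewrite !ltr_pdivlMr// /pair_form /=; lra.
Qed.

End product_form.

Section vL2.
Variables (R : realType) (n : nat).
Local Notation E := 'rV[R]_n.
Variable omega : set E.
Hypothesis mo : measurable omega.
Implicit Types f g h : E -> E.

Definition coordf (i : 'I_n) f : E -> R := fun x => f x ord0 i.

Lemma coordf_lin i a f g : coordf i (a *: f + g) = a *: coordf i f + coordf i g.
Proof. by apply/funext => x; rewrite /coordf !mxE. Qed.

Lemma coordfB i f g : coordf i (f - g) = coordf i f - coordf i g.
Proof. by apply/funext => x; rewrite /coordf !mxE. Qed.

Lemma vipE f g : vL2 omega f -> vL2 omega g ->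
  vip omega f g = \sum_i ip omega (coordf i f) (coordf i g).
Proof.
move=> Lf Lg; rewrite /vip /dot /Rintegral.
have I i : (lebesgue_rV R n).-integrable omega (EFin \o (fun x => f x ord0 i * g x ord0 i)).
  exact: (L2_integrableM mo (Lf i) (Lg i)).
under eq_integral do rewrite -sumEFin.
rewrite integral_sum// -sum_fine// => i _.
exact: integrable_fin_num (I i).
Qed.

Lemma vL2_prehilbert : prehilbert (vL2 omega) (vip omega).
Proof.
have H := L2_prehilbert mo.
have L0 : vL2 omega (0 : E -> E).
  move=> i; rewrite (_ : (fun x => _) = 0); first exact: (prehilbert0 H).
  by apply/funext => x; rewrite mxE.
have Ll a f g : vL2 omega f -> vL2 omega g -> vL2 omega (a *: f + g).
  by move=> Lf Lg i; rewrite -/(coordf i _) coordf_lin; apply: (prehilbert_lin H);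
    [exact: Lf|exact: Lg].
split=> //.
- by move=> f g Lf Lg; rewrite !vipE//; apply: eq_bigr => i _; apply: (formC H);
  [exact: Lf|exact: Lg].
- move=> a f g h Lf Lg Lh; rewrite !vipE//; last exact: Ll.
  rewrite mulr_sumr -big_split; apply: eq_bigr => i _ /=.
  by rewrite coordf_lin (form_linl H)//; [exact: Lf|exact: Lg|exact: Lh].
- by move=> f Lf; rewrite vipE// sumr_ge0// => i _; apply: (form_ge0 H); exact: Lf.
Qed.

Lemma vL2_complete : form_complete (vL2 omega) (vip omega).
Proof.
move=> u Lu uC; have H := L2_prehilbert mo.
have LB j k : vL2 omega (u j - u k) by exact: (prehilbertB vL2_prehilbert).
have /choice[l lP] i : exists l, L2 omega l /\ forall e, 0 < e ->
  exists N, forall k, (N <= k)%N ->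
    ip omega (coordf i (u k) - l) (coordf i (u k) - l) < e.
  have [|e e0|l] := L2_complete mo (u := fun k => coordf i (u k)); [by move=> k;
    exact: Lu| |by exists l].
  have [N NP] := uC _ e0; exists N => j k Nj Nk; apply: le_lt_trans (NP j k Nj Nk).
  rewrite vipE// (bigD1 i)//= -/(coordf i _) -/(coordf i _) -coordfB lerDl.
  by apply: sumr_ge0 => t _; apply: (form_ge0 H); exact: LB.
pose L : E -> E := fun x => \row_i l i x.
have cL i : coordf i L = l i by apply/funext => x; rewrite /coordf mxE.
have LL : vL2 omega L by move=> i; rewrite -/(coordf i _) cL; exact: (lP i).1.
exists L => // e e0.
have e1 : 0 < e / n.+1%:R by rewrite divr_gt0.
have /choice[N NP] i := (lP i).2 _ e1.
exists (\max_i N i)%N => k Nk.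
rewrite vipE//; try exact: (prehilbertB vL2_prehilbert).
apply: (@le_lt_trans _ _ (\sum_(i < n) e / n.+1%:R)).
  apply: ler_sum => i _; rewrite coordfB cL; apply/ltW/NP.
  exact: leq_trans (leq_bigmax i) Nk.
rewrite sumr_const card_ord -[_ *+ n]mulr_natr mulrAC -mulrA gtr_pMr// ltr_pdivrMr//.
by rewrite mul1r ltr_nat.
Qed.

End vL2.

(** * Integrals of directional derivatives *)

Section calculus.
Variables (R : realType) (n : nat).
Local Notation E := 'rV[R]_n.
Local Notation mu := (lebesgue_rV R n).
Implicit Types (f phi psi chi : E -> R) (omega : set E).

Lemma integrable_cube f C M : measurable_fun setT f -> (forall x, `|f x| <= C) ->
  (forall x, ~ cube n M x -> f x = 0) -> mu.-integrable setT (EFin \o f).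
Proof.
move=> mf fC f0; have mc := @measurable_cube R n M.
have : mu.-integrable (cube n M) (EFin \o f).
  apply: (@le_integrable _ _ _ mu _ mc _ (EFin \o cst C)) => //.
  - by apply/measurable_EFinP; exact: measurable_funS mf.
  - by move=> x _ /=; rewrite lee_fin (le_trans (fC x))// ler_norm.
  - apply/integrableP; split; first by apply/measurable_EFinP; exact: measurable_cst.
    rewrite /= integral_cst// lte_mul_pinfty//; exact: lebesgue_cube_lty.
move=> /(integrable_mkcond _ mc); congr (integrable _ _ _).
apply/funext => x; rewrite /restrict; case: ifPn => // /negP xM /=.
by rewrite f0// => /mem_set.
Qed.

Lemma integral_translate f (a : E) : mu.-integrable setT (EFin \o f) ->
  mu.-integrable setT (EFin \o (fun x => f (x + a))) ->
  (\int[mu]_x (f (x + a))%:E = \int[mu]_x (f x)%:E)%E.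
Proof.
move=> If Ifa; have mt := measurable_translate a.
have := @integral_pushforward _ _ _ _ R _ mt mu setT (EFin \o f) (measurable_int mu If).
rewrite preimage_setT => /(_ Ifa measurableT) /= <-.
apply: (eq_measure_integral mu (m1 := image_measure mu mt)) => A mA _.
exact: lebesgue_translate.
Qed.

Lemma derive_line f (e x : E) (t : R) : derivable f (x + t *: e) e ->
  is_derive t 1 (fun s => f (x + s *: e)) ('D_e f (x + t *: e)).
Proof.
move=> df.
have eqf : (fun h => h^-1 *: (((fun s => f (x + s *: e)) \o shift t) (h *: 1) - f (x + t *:
  e))) =
    (fun h => h^-1 *: ((f \o shift (x + t *: e)) (h *: e) - f (x + t *: e))).
  apply/funext => h /=; congr (_ *: (f _ - _)).
  by rewrite [h *: 1]mulr1 scalerDl addrCA.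
by apply: DeriveDef; rewrite /derivable /derive eqf.
Qed.

Lemma line_lipschitz f (e x : E) (h C : R) : 0 < h ->
  (forall y, derivable f y e) -> (forall y, `|'D_e f y| <= C) ->
  `|f (x + h *: e) - f x| <= C * h.
Proof.
move=> h0 df fC.
have D (t : R) : is_derive t 1 (fun s => f (x + s *: e)) ('D_e f (x + t *: e)) by exact:
  derive_line.
have [|c _] := @MVT R (fun s => f (x + s *: e)) (fun t => 'D_e f (x + t *: e)) 0 h h0 (fun
  t _ => D t).
  apply: derivable_within_continuous => t _; exact: (@ex_derive _ _ _ _ _ _ _ (D t)).
rewrite scale0r addr0 subr0 => ->.
by rewrite normrM (gtr0_norm h0) ler_wpM2r// ltW.
Qed.

Lemma difference_quotient_cvg f (e x : E) : derivable f x e ->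
  (fun k => k.+1%:R * (f (x + k.+1%:R^-1 *: e) - f x)) @ \oo --> 'D_e f x.
Proof.
move=> df.
have harm : (fun k => k.+1%:R^-1 : R) @ \oo --> 0^'.
  move=> A /= A0.
  have H : \forall k \near \oo, (k.+1%:R^-1 : R) != 0 ->
    A k.+1%:R^-1 by exact: (@cvg_harmonic R _ A0).
  by apply: filterS H => k; apply; rewrite invr_eq0 pnatr_eq0.
have := cvg_comp _ _ harm df; apply: cvg_trans.
rewrite (_ : (fun k => _) = (fun h => h^-1 *: ((f \o shift x) (h *: e) - f x)) \o (fun k =>
  k.+1%:R^-1))//.
by apply/funext => k; rewrite /= invrK [_ *: e + x]addrC.
Qed.

(** The difference quotients along e have integral 0 by translation invariance.
    By the mean value theorem they are bounded by C, and they vanish outside of a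
    cube, so that dominated convergence applies. *)
Lemma integral_derive_eq0 f (e : E) C M : continuous f -> (forall x, derivable f x e) ->
  (forall x, `|'D_e f x| <= C) -> (forall x, `|f x| <= C) ->
  (forall x, ~ cube n M x -> f x = 0) ->
  mu.-integrable setT (EFin \o 'D_e f) /\ \int[mu]_x 'D_e f x = 0.
Proof.
move=> cf df fC f0C fM.
have mf := continuous_measurable_rV cf.
pose q k x : R := k.+1%:R * (f (x + k.+1%:R^-1 *: e) - f x).
have If := integrable_cube mf f0C fM.
have mft k : measurable_fun setT (fun x : E => f (x + k.+1%:R^-1 *: e)).
  exact: (measurableT_comp mf (measurable_translate _)).
have cM x k : ~ cube n (M + `|e|) x -> f (x + k.+1%:R^-1 *: e) = 0.
  move=> xM; apply: fM => xeM; apply: xM.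
  have := @bounded_translate R n (k.+1%:R^-1 *: e) (cube n M) M (fun _ => id) x xeM.
  move=> H i; have := H i; rewrite !in_itv/= -!ler_norml => /le_trans; apply.
  rewrite lerD2l normrZ ler_piMl// ger0_norm ?invr_ge0//.
  by rewrite invf_le1 ?ltr0n// ler1n.
have cM0 x : ~ cube n (M + `|e|) x -> f x = 0.
  move=> xM; apply: fM => H; apply: xM => i; have := H i.
  rewrite !in_itv/= -!ler_norml => /le_trans; apply.
  by rewrite lerDl.
have Ift k : mu.-integrable setT (EFin \o (fun x => f (x + k.+1%:R^-1 *: e))).
  by apply: (integrable_cube (mft k)) => [x|x /cM]; [exact: f0C|exact].
have mq k : measurable_fun setT (EFin \o q k).
  by apply/measurable_EFinP; apply: measurable_funM => //; apply: measurable_funB.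
have qD x : (EFin \o q ^~ x) @ \oo --> ('D_e f x)%:E.
  by apply/cvg_EFin; [exact: nearW|exact: difference_quotient_cvg].
have q0 k x : ~ cube n (M + `|e|) x -> q k x = 0.
  by move=> xM; rewrite /q cM// cM0// subrr mulr0.
pose g x : R := C * \1_(cube n (M + `|e|)) x.
have C0 : 0 <= C by apply: le_trans (fC 0).
have qg k x : `|q k x| <= g x.
  rewrite /g; have [xM|xM] := pselect (cube n (M + `|e|) x); last first.
    by rewrite q0// normr0 mulr_ge0.
  rewrite indicE mem_set// mulr1 /q normrM ger0_norm// mulrC -ler_pdivlMr//.
  exact: line_lipschitz.
have Ig : mu.-integrable setT (EFin \o g).
  apply: (@integrable_cube g C (M + `|e|)).
  - apply: measurable_funM => //; apply: measurable_indic; exact: measurable_cube.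
  - by move=> x; rewrite /g indicE; case: (_ \in _); rewrite ?mulr1 ?mulr0 ?normr0// ger0_norm.
  - by move=> x xM; rewrite /g indicE memNset// mulr0.
have mD : measurable_fun setT (EFin \o 'D_e f).
  by apply: (emeasurable_fun_cvg (fun k => EFin \o q k)) => // x _; exact: qD.
have [ID _ DC] := @dominated_convergence _ _ R mu setT measurableT (fun k => EFin \o q k)
  (EFin \o 'D_e f) (EFin \o g) mq mD (aeW _ (fun x _ => qD x)) Ig
  (aeW _ (fun x k _ => qg k x)).
split => //; rewrite /Rintegral.
have := DC; rewrite (_ : [sequence _]_k = cst 0%E); last first.
  apply/funext => k /=; rewrite /q; under eq_integral do rewrite EFinM EFinB.
  rewrite integralZl//; last exact: (integrableB measurableT (Ift k) If).
  rewrite integralB//; last exact: Ift.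
  rewrite integral_translate//.
  by rewrite subee ?mule0//; exact: integrable_fin_num If.
by move/(cvg_unique _ (@cvg_cst _ _ _ _ _)) => <-.
Qed.

End calculus.

(** * Test functions and integration by parts *)

Section test_functions.
Variables (R : realType) (n : nat).
Local Notation E := 'rV[R]_n.
Local Notation mu := (lebesgue_rV R n).
Implicit Types (f phi psi : E -> R) (omega : set E).
Local Notation e_ i := (delta_mx ord0 i : E).

(** What is used of a smooth compactly supported function and of its partial
    derivatives in integrals. *)
Definition bounded_cube_support f := [/\ continuous f,
  exists C, forall x, `|f x| <= C & exists M, forall x, ~ cube n M x -> f x = 0].

Lemma L2_bounded_cube_support omega f : measurable omega -> bounded_cube_support f ->
  L2 omega f.
Proof.
move=> mo [cf [C fC] [M fM]]; have mf := continuous_measurable_rV cf.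
have mfo : measurable_fun omega f by exact: measurable_funS mf.
split=> //.
have I : mu.-integrable setT (EFin \o (fun x => f x ^+ 2)).
  apply: (@integrable_cube _ _ _ (C ^+ 2) M); first exact: measurable_funX.
    by move=> x; rewrite normrX lerXn2r ?nnegrE// (le_trans _ (fC x)).
  by move=> x /fM ->; rewrite expr0n.
have /integrableP[_] := integrableS measurableT mo (@subsetT _ _) I.
by under eq_integral do rewrite /= ger0_norm ?sqr_ge0//.
Qed.

Lemma compact_support_bounded f (K : set E) : continuous f -> compact K ->
  (forall x, f x != 0 -> K x) -> bounded_cube_support f.
Proof.
move=> cf cK fK; split => //.
  have : compact (f @` K) by apply: continuous_compact => //; exact: continuous_subspaceT.
  move=> /compact_bounded[C [_ /(_ (`|C| + 1))]];
    rewrite (le_lt_trans (ler_norm _)) ?ltrDl// => /(_ isT) fC.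
  exists (`|C| + 1) => x; have [->|/fK Kx] := eqVneq (f x) 0; first by rewrite normr0 addr_ge0.
  by apply: fC; exists x.
have [M KM] := bounded_cube (compact_bounded cK); exists M => x xM.
by apply: contrapT => /eqP/fK/KM.
Qed.

Lemma partial_support f i x : partial i f x != 0 -> closure [set y | f y != 0] x.
Proof.
apply: contraPP => ncl; apply/negP; rewrite negbK; apply/eqP.
rewrite /partial (near_eq_derive (g := cst 0)) ?derive_cst//.
have : open (~` closure [set y | f y != 0]) by apply: closed_openC; exact: closed_closure.
move=> oc; have := open_nbhs_nbhs (conj oc ncl); apply: filterS => y ny.
by apply: contrapT => /eqP fy; apply: ny; exact: subset_closure.
Qed.

Lemma smooth_continuous phi : smooth phi -> continuous phi.
Proof. by move=> /(_ [::])[]. Qed.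
Lemma smooth_partial_continuous phi i : smooth phi -> continuous (partial i phi).
Proof. by move=> /(_ [:: i])[]. Qed.
Lemma smooth_derivable phi i x : smooth phi -> derivable phi x (e_ i).
Proof. by move=> /(_ [::])[_]. Qed.

Lemma partial_lin i a phi psi : (forall x, derivable phi x (e_ i)) ->
  (forall x, derivable psi x (e_ i)) ->
  partial i (a *: phi + psi) = a *: partial i phi + partial i psi.
Proof.
move=> dphi dpsi; apply/funext => x; rewrite /partial deriveD//; last exact: derivableZ.
by rewrite deriveZ.
Qed.

Lemma smooth_lin a phi psi : smooth phi -> smooth psi -> smooth (a *: phi + psi).
Proof.
move=> sp sq s.
have -> : foldr (@partial R n) (a *: phi + psi) s =
    a *: foldr (@partial R n) phi s + foldr (@partial R n) psi s.
  elim: s => //= i s ->; rewrite partial_lin// => x; [exact: (sp s).2|exact: (sq s).2].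
split=> [x|i x].
  apply: continuousD; last exact: (sq s).1.
  by apply: (@continuousM R E (cst a)); [exact: cst_continuous|exact: (sp s).1].
by apply: derivableD; [apply: derivableZ; exact: (sp s).2|exact: (sq s).2].
Qed.

Lemma grad_lin a phi psi : smooth phi -> smooth psi ->
  grad (a *: phi + psi) = a *: grad phi + grad psi.
Proof.
move=> sp sq; apply/funext => x; apply/rowP => i; rewrite !mxE partial_lin//;
  by move=> y; exact: smooth_derivable.
Qed.

Lemma Cc_smooth_lin omega a phi psi : Cc_smooth omega phi -> Cc_smooth omega psi ->
  Cc_smooth omega (a *: phi + psi).
Proof.
move=> [sp cp op] [sq cq oq].
have sub : closure [set x | (a *: phi + psi) x != 0] `<=`
    closure [set x | phi x != 0] `|` closure [set x | psi x != 0].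
  rewrite -closureU; apply: closure_subset => x /=; apply: contraNP => /not_orP[/negP + /negP].
  rewrite !negbK => /eqP p0 /eqP q0.
  by rewrite (_ : (_ + _) x = a * phi x + psi x)// p0 q0 mulr0 addr0.
split; first exact: smooth_lin.
- apply: subclosed_compact sub; first exact: closed_closure.
  exact: compactU.
- by move=> x /sub[/op|/oq].
Qed.

Lemma Cc_smooth0 omega : Cc_smooth omega (0 : E -> R).
Proof.
have e0 : [set x : E | (0 : E -> R) x != 0] = set0.
  by apply/seteqP; split=> x //=; rewrite eqxx.
have f0 s : foldr (@partial R n) (0 : E -> R) s = 0.
  by elim: s => //= i s ->; apply/funext => x; rewrite /partial derive_cst.
split; last by rewrite e0 closure0.
- by move=> s; rewrite f0; split=> [x|i x]; [exact: cst_continuous|exact: derivable_cst].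
- by rewrite e0 closure0; exact: compact0.
Qed.

Lemma Cc_smooth_sub A B phi : A `<=` B -> Cc_smooth A phi -> Cc_smooth B phi.
Proof. by move=> AB [s c o]; split=> // x /o/AB. Qed.

Section facts.
Variables (omega : set E) (phi : E -> R).
Hypothesis cphi : Cc_smooth omega phi.

Lemma Cc_smooth_bounded : bounded_cube_support phi.
Proof.
case: cphi => s c o; apply: (compact_support_bounded (smooth_continuous s) c).
by move=> x fx; exact: subset_closure.
Qed.

Lemma Cc_partial_bounded i : bounded_cube_support (partial i phi).
Proof.
case: cphi => s c o; apply: (compact_support_bounded (smooth_partial_continuous s) c).
exact: partial_support.
Qed.

Lemma Cc_smooth_out x : ~ omega x -> phi x = 0.
Proof.
case: cphi => s c o xo; apply: contrapT => /eqP fx; apply/xo/o; exact: subset_closure.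
Qed.

Lemma Cc_partial_out i x : ~ omega x -> partial i phi x = 0.
Proof.
case: cphi => s c o xo; apply: contrapT => /eqP fx; apply/xo/o; exact: partial_support fx.
Qed.

Lemma Cc_smooth_L2 A : measurable A -> L2 A phi.
Proof. by move=> mA; apply: L2_bounded_cube_support => //; exact: Cc_smooth_bounded. Qed.

Lemma Cc_partial_L2 A i : measurable A -> L2 A (partial i phi).
Proof. by move=> mA; apply: L2_bounded_cube_support => //; exact: Cc_partial_bounded. Qed.

Lemma Cc_grad_vL2 A : measurable A -> vL2 A (grad phi).
Proof.
move=> mA i; rewrite (_ : (fun x => _) = partial i phi); first exact: Cc_partial_L2.
by apply/funext => x; rewrite mxE.
Qed.

End facts.

(** Allows test functions supported in a small set to be used on a larger one. *)
Lemma ip_vanish (A B : set E) f g : A `<=` B -> (forall x, ~ A x -> g x = 0) ->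
  ip A f g = ip B f g.
Proof.
move=> AB g0; rewrite /ip Rintegral_mkcond [RHS]Rintegral_mkcond.
apply: eq_Rintegral => x _; rewrite /restrict;
  case: ifPn => [/set_mem/AB/mem_set ->//|/negP xA].
by case: ifPn => // _; rewrite g0 ?mulr0// => /mem_set.
Qed.

(** The integral of the partial derivative of phi psi vanishes. *)
Lemma ip_partial (A B C : set E) phi psi i : measurable C -> B `<=` C -> Cc_smooth A phi ->
  Cc_smooth B psi ->
  ip C phi (partial i psi) = - ip C (partial i phi) psi.
Proof.
move=> mC BC cphi cpsi.
have [cf [C1 f1] [M1 m1]] := Cc_smooth_bounded cphi.
have [cg [C2 g2] [M2 m2]] := Cc_smooth_bounded cpsi.
have [cdf [C3 f3] [M3 m3]] := Cc_partial_bounded cphi i.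
have [cdg [C4 g4] [M4 m4]] := Cc_partial_bounded cpsi i.
have df x : derivable phi x (e_ i) by apply: smooth_derivable; case: cphi.
have dg x : derivable psi x (e_ i) by apply: smooth_derivable; case: cpsi.
have D x : 'D_(e_ i) (phi * psi) x = phi x * partial i psi x + partial i phi x * psi x.
  by rewrite deriveM//; congr (_ + _); exact: mulrC.
have C10 : 0 <= C1 by apply: le_trans (f1 0).
have C20 : 0 <= C2 by apply: le_trans (g2 0).
have C30 : 0 <= C3 by apply: le_trans (f3 0).
have C40 : 0 <= C4 by apply: le_trans (g4 0).
pose C0 := C1 * C2 + (C1 * C4 + C3 * C2).
have [|||||_ +] := @integral_derive_eq0 R n (phi * psi) (e_ i) C0 M2.
- by move=> x; apply: continuousM; [exact: cf|exact: cg].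
- by move=> x; exact: derivableM.
- move=> x; rewrite D (le_trans (ler_normD _ _))// !normrM.
  rewrite -[leLHS]add0r lerD ?mulr_ge0// lerD// ler_pM//.
- move=> x; rewrite normrM -[leLHS]addr0 lerD ?addr_ge0 ?mulr_ge0// ler_pM//.
- by move=> x /m2 p0; rewrite (_ : (_ * _) x = phi x * psi x)// p0 mulr0.
under eq_Rintegral do rewrite D.
have L1 := Cc_smooth_L2 cphi measurableT.
have L2' := Cc_smooth_L2 cpsi measurableT.
have L3 := Cc_partial_L2 cphi i measurableT.
have L4 := Cc_partial_L2 cpsi i measurableT.
rewrite (RintegralD measurableT (L2_integrableM measurableT L1 L4)
  (L2_integrableM measurableT L3 L2')).
rewrite -/(ip _ _ _) -/(ip _ _ _) => /eqP; rewrite addr_eq0 => /eqP H.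
have CT : C `<=` setT by [].
have hC (x : E) : ~ C x -> ~ B x by move=> xC /BC.
rewrite (ip_vanish _ CT); last by move=> x /hC; exact: (Cc_partial_out cpsi i).
rewrite (ip_vanish _ CT); last by move=> x /hC; exact: (Cc_smooth_out cpsi).
exact: H.
Qed.

End test_functions.

(** * H^1 and H(div) as orthogonal complements *)

Section orthogonal.
Variables (R : realType) (W : lmodType R) (K : set W) (B : W -> W -> R).
Hypothesis H : prehilbert K B.

Definition orth (P : set W) : set W := [set x | K x /\ forall p, P p -> B x p = 0].

Lemma orth_lin P a x y : P `<=` K -> orth P x -> orth P y -> orth P (a *: x + y).
Proof.
move=> PK [Kx Px] [Ky Py]; split=> [|p Pp]; first exact: (prehilbert_lin H).
by rewrite (form_linl H)//; [rewrite Px// Py// mulr0 addr0|exact: PK].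
Qed.

Lemma form_double x y : K x -> K y -> B (x + y) (x + y) <= 2 * B x x + 2 * B y y.
Proof.
move=> Kx Ky; have := form_ge0 H (prehilbert_lin H (-1) Kx Ky).
have := form_expand H 1 Kx Ky; rewrite scale1r => ->.
rewrite (form_expand H (-1) Kx Ky); lra.
Qed.

(** Orthogonality to a fixed p is a continuous condition, by Cauchy-Schwarz. *)
Lemma orth_closed P v : P `<=` K -> K v ->
  (forall e, 0 < e -> exists2 s, orth P s & B (v - s) (v - s) < e) -> orth P v.
Proof.
move=> PK Kv vP; split=> // p Pp; have Kp := PK _ Pp.
apply/eqP; rewrite -sqrf_eq0 eq_le sqr_ge0 andbT; apply/ler_addgt0Pr => e e0; rewrite add0r.
have p0 := form_ge0 H Kp.
have c0 : 0 < e / (B p p + 1) by rewrite divr_gt0// ltr_wpDl.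
have [s [Ks sP] vs] := vP _ c0.
have Kvs : K (v - s) by exact: (prehilbertB H).
have -> : B v p = B (v - s) p by rewrite (formBl H)// sP// subr0.
apply: le_trans (form_cauchy_schwarz H Kvs Kp) _.
rewrite -[leRHS](@divfK _ (B p p + 1)) ?gt_eqF ?ltr_wpDl//.
by rewrite ler_pM ?(form_ge0 H)// ?ltW// ltrDl.
Qed.

Lemma orth_projection P y : P `<=` K -> form_complete K B -> K y ->
  exists2 z, orth P z & forall x, orth P x -> B (y - z) x = 0.
Proof.
move=> PK cK Ky; apply: (form_projection H) => //.
- by move=> x [].
- by split=> [|p /PK Kp]; [exact: (prehilbert0 H)|exact: (form0l H)].
- by move=> a x z; exact: orth_lin.
- by move=> v Kv; exact: orth_closed.
Qed.

End orthogonal.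

Section spaces.
Variables (R : realType) (n : nat).
Local Notation E := 'rV[R]_n.
Local Notation mu := (lebesgue_rV R n).
Local Notation e_ i := (delta_mx ord0 i : E).
Implicit Types (phi psi : E -> R).

Definition L2grad omega : set ((E -> R) * (E -> E)) := L2 omega `*` vL2 omega.
Definition L2div omega : set ((E -> E) * (E -> R)) := vL2 omega `*` L2 omega.
Definition form_H1 (d : R) omega := pair_form (@ip R n omega) (@vip R n omega) (d ^- 2) 1.
Definition form_Hdiv (d : R) omega := pair_form (@vip R n omega) (@ip R n omega) 1 (d ^+ 2).

(** Fields phi e_i test partial derivatives one at a time. *)
Definition axis_field i (phi : E -> R) : E -> E := fun x => phi x *: e_ i.

Lemma coordf_axis i j phi : coordf j (axis_field i phi) = if j == i then phi else 0.
Proof.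
by apply/funext => x; rewrite /coordf !mxE eqxx; case: eqP => _; rewrite ?mulr1 ?mulr0.
Qed.

Lemma coordf_grad j phi : coordf j (grad phi) = partial j phi.
Proof. by apply/funext => x; rewrite /coordf !mxE. Qed.

Section domain.
Variable omega : set E.
Hypothesis mo : measurable omega.

Lemma ip_ge0 f : 0 <= ip omega f f.
Proof. by apply: Rintegral_ge0 => x _; rewrite -expr2 sqr_ge0. Qed.

Lemma vip_ge0 f : 0 <= vip omega f f.
Proof. by apply: Rintegral_ge0 => x _; apply: sumr_ge0 => i _; rewrite -expr2 sqr_ge0. Qed.

Lemma norm2_sqr f : norm2 omega f ^+ 2 = ip omega f f.
Proof. by rewrite sqr_sqrtr// ip_ge0. Qed.

Lemma vnorm2_sqr f : vnorm2 omega f ^+ 2 = vip omega f f.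
Proof. by rewrite sqr_sqrtr// vip_ge0. Qed.

Lemma norm_H1_sqr d v : norm_H1 d omega v ^+ 2 = form_H1 d omega v v.
Proof.
rewrite /norm_H1 norm2_sqr vnorm2_sqr sqr_sqrtr; first by rewrite /form_H1 /pair_form mul1r.
apply: addr_ge0; last exact: vip_ge0.
by apply: mulr_ge0; [rewrite invr_ge0; exact: sqr_ge0|exact: ip_ge0].
Qed.

Lemma norm_Hdiv_sqr d v : norm_Hdiv d omega v ^+ 2 = form_Hdiv d omega v v.
Proof.
rewrite /norm_Hdiv norm2_sqr vnorm2_sqr sqr_sqrtr; first by rewrite /form_Hdiv /pair_form mul1r.
apply: addr_ge0; first exact: vip_ge0.
by apply: mulr_ge0; [exact: sqr_ge0|exact: ip_ge0].
Qed.

Section scaled.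
Variable d : R.
Hypothesis d0 : 0 < d.

Let dN0 : 0 < d ^- 2. Proof. by rewrite invr_gt0 exprn_gt0. Qed.
Let dP0 : 0 < d ^+ 2. Proof. exact: exprn_gt0. Qed.

Lemma form_H1_prehilbert : prehilbert (L2grad omega) (form_H1 d omega).
Proof. by apply: pair_prehilbert => //; [exact: L2_prehilbert|exact: vL2_prehilbert]. Qed.

Lemma form_Hdiv_prehilbert : prehilbert (L2div omega) (form_Hdiv d omega).
Proof. by apply: pair_prehilbert => //; [exact: vL2_prehilbert|exact: L2_prehilbert]. Qed.

Lemma form_H1_complete : form_complete (L2grad omega) (form_H1 d omega).
Proof.
by apply: pair_complete => //;
  [exact: L2_prehilbert|exact: vL2_prehilbert|exact: L2_complete|exact: vL2_complete].
Qed.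

Lemma form_Hdiv_complete : form_complete (L2div omega) (form_Hdiv d omega).
Proof.
by apply: pair_complete => //;
  [exact: vL2_prehilbert|exact: L2_prehilbert|exact: vL2_complete|exact: L2_complete].
Qed.

Lemma axis_vL2 i phi : L2 omega phi -> vL2 omega (axis_field i phi).
Proof.
move=> Lphi j; rewrite -/(coordf j _) coordf_axis; case: ifP => // _; exact: L20.
Qed.

Lemma vip_axis i phi (f : E -> E) : L2 omega phi -> vL2 omega f ->
  vip omega f (axis_field i phi) = ip omega (coordf i f) phi.
Proof.
move=> Lphi Lf; rewrite vipE//; last exact: axis_vL2.
rewrite (bigD1 i)//= coordf_axis eqxx big1 ?addr0// => j ji.
rewrite coordf_axis (negbTE ji) (formC (L2_prehilbert mo) (Lf j))//; last exact: L20.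
by rewrite (form0l (L2_prehilbert mo))//; exact: Lf.
Qed.

(** The weights d^2 and d^-2 (below) compensate those of the forms, so that
    orthogonality to these pairs is integration by parts against phi. *)
Definition H1_tests := [set w : (E -> R) * (E -> E) | exists2 phi, Cc_smooth omega phi &
  exists i, w = (d ^+ 2 *: partial i phi, axis_field i phi)].

Definition Hdiv_tests := [set w : (E -> E) * (E -> R) | exists2 phi, Cc_smooth omega phi &
  w = (grad phi, d ^- 2 *: phi)].

Lemma H1_tests_sub : H1_tests `<=` L2grad omega.
Proof.
move=> _ [phi cphi [i ->]]; split=> /=.
  by apply: (prehilbertZ (L2_prehilbert mo)); exact: (Cc_partial_L2 cphi i mo).
by apply: axis_vL2; exact: (Cc_smooth_L2 cphi mo).
Qed.

Lemma Hdiv_tests_sub : Hdiv_tests `<=` L2div omega.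
Proof.
move=> _ [phi cphi ->]; split=> /=; first exact: (Cc_grad_vL2 cphi mo).
by apply: (prehilbertZ (L2_prehilbert mo)); exact: (Cc_smooth_L2 cphi mo).
Qed.

(** Being an orthogonal complement makes H^1 a closed subspace of a complete
    space; this gives projections on it at once. *)
Lemma H1_orth : H1 omega = orth (L2grad omega) (form_H1 d omega) H1_tests.
Proof.
have E0 v phi i : L2grad omega v -> Cc_smooth omega phi ->
    form_H1 d omega v (d ^+ 2 *: partial i phi, axis_field i phi) =
    ip omega v.1 (partial i phi) + ip omega (coordf i v.2) phi.
  move=> [Lv1 Lv2] cphi; have Lp := Cc_smooth_L2 cphi mo.
  have Ldp := Cc_partial_L2 cphi i mo.
  rewrite /form_H1 /pair_form /= (formZr (L2_prehilbert mo))// vip_axis//.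
  by rewrite mul1r mulrA mulVf ?mul1r// expf_neq0// gt_eqF.
apply/seteqP; split=> v.
  case=> L1 L2 H; split=> // _ [phi cphi [i ->]].
  by rewrite E0// H// addNr.
case=> -[L1 L2 H]; split=> // phi cphi i.
have Ht : H1_tests (d ^+ 2 *: partial i phi, axis_field i phi) by exists phi => //; exists i.
by have := H _ Ht; rewrite E0// => /eqP; rewrite addr_eq0 => /eqP.
Qed.

Lemma Hdiv_orth : Hdiv omega = orth (L2div omega) (form_Hdiv d omega) Hdiv_tests.
Proof.
have E0 v phi : L2div omega v -> Cc_smooth omega phi ->
    form_Hdiv d omega v (grad phi, d ^- 2 *: phi) = vip omega v.1 (grad phi) + ip omega v.2 phi.
  move=> [Lv1 Lv2] cphi; have Lp := Cc_smooth_L2 cphi mo.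
  rewrite /form_Hdiv /pair_form /= (formZr (L2_prehilbert mo))//.
  by rewrite mul1r mulrA mulfV ?mul1r// expf_neq0// gt_eqF.
apply/seteqP; split=> v.
  case=> L1 L2 H; split=> // _ [phi cphi ->].
  by rewrite E0// H// addNr.
case=> -[L1 L2 H]; split=> // phi cphi.
have Ht : Hdiv_tests (grad phi, d ^- 2 *: phi) by exists phi.
by have := H _ Ht; rewrite E0// => /eqP; rewrite addr_eq0 => /eqP.
Qed.

Lemma H1_lin a v w : H1 omega v -> H1 omega w -> H1 omega (a *: v + w).
Proof. rewrite H1_orth; apply: (orth_lin form_H1_prehilbert); exact: H1_tests_sub. Qed.

Lemma Hdiv_lin a v w : Hdiv omega v -> Hdiv omega w -> Hdiv omega (a *: v + w).
Proof. rewrite Hdiv_orth; apply: (orth_lin form_Hdiv_prehilbert); exact: Hdiv_tests_sub. Qed.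

Lemma H1_projection y : L2grad omega y ->
  exists2 z, H1 omega z & forall x, H1 omega x -> form_H1 d omega (y - z) x = 0.
Proof.
rewrite H1_orth; apply: (orth_projection form_H1_prehilbert H1_tests_sub);
  exact: form_H1_complete.
Qed.

Lemma Hdiv_projection y : L2div omega y ->
  exists2 z, Hdiv omega z & forall x, Hdiv omega x -> form_Hdiv d omega (y - z) x = 0.
Proof.
rewrite Hdiv_orth; apply: (orth_projection form_Hdiv_prehilbert Hdiv_tests_sub);
  exact: form_Hdiv_complete.
Qed.

End scaled.

Lemma H1_L2grad v : H1 omega v -> L2grad omega v. Proof. by case. Qed.
Lemma Hdiv_L2div v : Hdiv omega v -> L2div omega v. Proof. by case. Qed.

Lemma Cc_H1 A phi : Cc_smooth A phi -> H1 omega (phi, grad phi).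
Proof.
move=> cphi; split=> /=; first exact: (Cc_smooth_L2 cphi mo).
  exact: (Cc_grad_vL2 cphi mo).
move=> psi cpsi i; rewrite (ip_partial i mo _ cphi cpsi)//.
by rewrite -/(coordf i _) coordf_grad.
Qed.

(** The divergence of phi e_i is the i-th partial derivative of phi. *)
Lemma Cc_Hdiv A phi i : Cc_smooth A phi -> Hdiv omega (axis_field i phi, partial i phi).
Proof.
move=> cphi; have Lp := Cc_smooth_L2 cphi mo; split=> /=.
- exact: axis_vL2.
- exact: (Cc_partial_L2 cphi i mo).
- move=> psi cpsi; have Lg := Cc_grad_vL2 cpsi mo.
  rewrite (formC (vL2_prehilbert mo)) ?vip_axis//; last exact: axis_vL2.
  rewrite coordf_grad (formC (L2_prehilbert mo))//; last exact: (Cc_partial_L2 cpsi i mo).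
  by rewrite (ip_partial i mo _ cphi cpsi).
Qed.

Lemma Cc_H10 phi : Cc_smooth omega phi -> H10 omega (phi, grad phi).
Proof.
move=> cphi; split; first exact: Cc_H1 cphi.
move=> e e0; exists phi => //; rewrite subrr.
rewrite (_ : norm_H1 1 omega 0 = 0)//; apply/eqP; rewrite -sqrf_eq0 norm_H1_sqr.
have H := form_H1_prehilbert ltr01.
by rewrite (form0l H)//; exact: (prehilbert0 H).
Qed.

End domain.
End spaces.

(** * H^1_0, and integrals over a mesh *)

Section H10_space.
Variables (R : realType) (n : nat).
Local Notation E := 'rV[R]_n.
Implicit Types (phi psi : E -> R).
Variable Omega : set E.
Hypothesis mO : measurable Omega.

Lemma H10_approx v : H10 Omega v -> forall e, 0 < e ->
  exists2 phi, Cc_smooth Omega phi & form_H1 1 Omega (v - (phi, grad phi)) (v - (phi,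
    grad phi)) < e.
Proof.
case=> _ ap e e0; have se0 : 0 < Num.sqrt e by rewrite sqrtr_gt0.
have [phi cphi lt] := ap _ se0; exists phi => //.
rewrite -norm_H1_sqr -(sqr_sqrtr (ltW e0)) ltrXn2r// ?nnegrE ?sqrtr_ge0//.
Qed.

Lemma approx_H10 v : H1 Omega v -> (forall e, 0 < e ->
  exists2 phi, Cc_smooth Omega phi & form_H1 1 Omega (v - (phi, grad phi)) (v - (phi,
    grad phi)) < e) ->
  H10 Omega v.
Proof.
move=> Hv ap; split=> // e e0; have [phi cphi lt] := ap _ (exprn_gt0 2 e0); exists phi => //.
by move: lt; rewrite -norm_H1_sqr ltr_pXn2r// nnegrE ?sqrtr_ge0// ltW.
Qed.

Let H1form := form_H1_prehilbert mO (@ltr01 R).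

Lemma H10_H1 v : H10 Omega v -> H1 Omega v. Proof. by case. Qed.
Lemma H10_L2grad v : H10 Omega v -> L2grad Omega v. Proof. by move=> /H10_H1/H1_L2grad. Qed.

Lemma Cc_L2grad phi : Cc_smooth Omega phi -> L2grad Omega (phi, grad phi).
Proof. by move=> /(Cc_H1 mO)/H1_L2grad. Qed.

Lemma H10_0 : H10 Omega 0.
Proof.
have := Cc_H10 mO (@Cc_smooth0 R n Omega); congr H10; congr pair.
by apply/funext => x; apply/rowP => i; rewrite !mxE /partial derive_cst.
Qed.

(** Combinations of approximating test functions are test functions. *)
Lemma H10_lin a v w : H10 Omega v -> H10 Omega w -> H10 Omega (a *: v + w).
Proof.
move=> Hv Hw; apply: approx_H10; first by apply: (H1_lin mO (@ltr01 R)); exact: H10_H1.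
move=> e e0.
pose c := e / (4 * (a ^+ 2 + 1)).
have a1 : 0 < a ^+ 2 + 1 by rewrite ltr_wpDl ?sqr_ge0.
have c0 : 0 < c by rewrite divr_gt0// mulr_gt0.
have ec : e = 4 * (a ^+ 2 + 1) * c by rewrite /c; field; rewrite gt_eqF.
have [p cp vp] := H10_approx Hv c0.
have [q cq wq] := H10_approx Hw c0.
exists (a *: p + q); first exact: Cc_smooth_lin.
have [sp _ _] := cp; have [sq _ _] := cq.
have -> : a *: v + w - (a *: p + q, grad (a *: p + q)) =
  a *: (v - (p, grad p)) + (w - (q, grad q)).
  rewrite grad_lin// scalerBr [RHS]addrACA -opprD; congr (_ - _).
have Kp := prehilbertB H1form (H10_L2grad Hv) (Cc_L2grad cp).
have Kq := prehilbertB H1form (H10_L2grad Hw) (Cc_L2grad cq).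
move: vp wq Kp Kq; move: (v - _) (w - _) => x y xc yc Kx Ky.
apply: le_lt_trans (form_double H1form (prehilbertZ H1form a Kx) Ky) _.
have -> : form_H1 1 Omega (a *: x) (a *: x) = a ^+ 2 * form_H1 1 Omega x x.
  have Kax := prehilbertZ H1form a Kx.
  by rewrite (formZl H1form a Kx Kax) (formZr H1form a Kx Kx) mulrA.
have a2 := sqr_ge0 a.
have := ler_wpM2l a2 (ltW xc).
move: xc yc; rewrite ec; move: (form_H1 _ _ _ _) (form_H1 _ _ _ _) => X Y; lra.
Qed.

Lemma form_H1_le d v : 0 < d -> form_H1 1 Omega v v <= (d ^+ 2 + 1) * form_H1 d Omega v v.
Proof.
move=> d0; rewrite /form_H1 /pair_form expr1n invr1 !mul1r.
have := ip_ge0 Omega v.1; have := vip_ge0 Omega v.2.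
move: (ip _ _ _) (vip _ _ _) => X Y Y0 X0.
have dP0 : 0 < d ^+ 2 by exact: exprn_gt0.
have e : d ^+ 2 * (d ^- 2 * X) = X by rewrite mulrA divff ?mul1r// gt_eqF.
have : 0 <= d ^- 2 * X by rewrite mulr_ge0// invr_ge0 ltW.
move: e; move: (d ^- 2 * X) => Z e Z0.
have := mulr_ge0 (ltW dP0) Y0; rewrite mulrDl mulrDr e; lra.
Qed.

Lemma H10_closed d v : 0 < d -> L2grad Omega v ->
  (forall e, 0 < e -> exists2 s, H10 Omega s & form_H1 d Omega (v - s) (v - s) < e) ->
    H10 Omega v.
Proof.
move=> d0 Kv ap; have H := form_H1_prehilbert mO d0.
have Hv : H1 Omega v.
  rewrite (H1_orth mO d0); apply: (orth_closed H (@H1_tests_sub _ _ _ mO d) Kv).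
  move=> e /ap[s Hs vs]; exists s => //.
  by rewrite -(H1_orth mO d0); exact: H10_H1.
apply: approx_H10 => // e e0.
have D0 : 0 < d ^+ 2 + 1 by rewrite ltr_wpDl ?sqr_ge0.
have c0 : 0 < e / 4 / (d ^+ 2 + 1) by rewrite !divr_gt0.
have [s Hs vs] := ap _ c0.
have [|phi cphi sphi] := H10_approx Hs (e := e / 4); first by rewrite divr_gt0.
exists phi => //.
have Kvs := prehilbertB H Kv (H10_L2grad Hs).
have Ksp := prehilbertB H (H10_L2grad Hs) (Cc_L2grad cphi).
rewrite -(subrK s v) -addrA.
apply: le_lt_trans (form_double H1form Kvs Ksp) _.
move: vs; rewrite ltr_pdivlMr// => vs.
have := form_H1_le (v - s) d0; rewrite mulrC.
move: vs sphi; move: (form_H1 d _ _ _) (form_H1 1 _ (v - s) _) (form_H1 1 _ (s - _) _) => X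
  Y Z; lra.
Qed.

Lemma H10_projection d y : 0 < d -> L2grad Omega y ->
  exists2 z, H10 Omega z & forall x, H10 Omega x -> form_H1 d Omega (y - z) x = 0.
Proof.
move=> d0 Ky; have H := form_H1_prehilbert mO d0.
have [|||||z Hz zP] := @form_projection R _ _ _ H (H10 Omega) y (form_H1_complete mO d0);
  last by exists z.
- exact: H10_L2grad.
- exact: H10_0.
- exact: H10_lin.
- move=> v Kv ap; exact: H10_closed d0 Kv ap.
- exact: Ky.
Qed.

(** True for test functions by the definition of the weak divergence, and
    preserved by limits. It says that the traces of H^1_0 functions vanish on
    conforming fluxes. *)
Lemma H10_Hdiv_orth v tau : H10 Omega v -> Hdiv Omega tau ->
  ip Omega v.1 tau.2 + vip Omega v.2 tau.1 = 0.
Proof.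
move=> Hv Ht; have [Lt1 Lt2 _] := Ht.
pose p := (tau.2, tau.1); have Kp : L2grad Omega p by [].
have B1 w : form_H1 1 Omega w p = ip Omega w.1 tau.2 + vip Omega w.2 tau.1.
  by rewrite /form_H1 /pair_form expr1n invr1 !mul1r.
rewrite -B1; have := orth_closed H1form (P := [set p]) (v := v).
case=> [_ ->//|||_ ->//]; first exact: H10_L2grad.
move=> e e0; have [phi cphi lt] := H10_approx Hv e0; exists (phi, grad phi) => //.
split=> [|_ ->]; first exact: Cc_L2grad.
rewrite B1 /= (formC (vL2_prehilbert mO)) ?(formC (L2_prehilbert mO) _ Lt2)//.
- by case: Ht => _ _ ->//; rewrite addrC addNr.
- exact: (Cc_smooth_L2 cphi mO).
- exact: (Cc_grad_vL2 cphi mO).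
Qed.

End H10_space.

Section mesh_additivity.
Variables (R : realType) (n : nat).
Local Notation E := 'rV[R]_n.
Local Notation mu := (lebesgue_rV R n).
Variables (Omega : set E) (N : nat) (T : 'I_N -> set E).
Hypotheses (bO : bounded_set Omega) (lO : lipschitz_domain Omega) (mT : mesh Omega T).

Lemma measurable_domain : measurable Omega.
Proof. by case: lO => oO _ _ _; exact: open_measurable_rV. Qed.

Lemma measurable_element i : measurable (T i).
Proof. by have [oO _ _ _] := mesh_lipschitz mT i; exact: open_measurable_rV. Qed.

Lemma bounded_element i : bounded_set (T i).
Proof.
case: bO => M [rM HM]; exists M; split=> // x Mx y Ty; exact: HM Mx _ (mesh_sub mT Ty).
Qed.

Definition elements : set E := \bigcup_i T i.

Lemma measurable_elements : measurable elements.
Proof. by apply: fin_bigcup_measurable => // i _; exact: measurable_element. Qed.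

Lemma elements_sub : elements `<=` Omega.
Proof. by move=> x [i _ /(mesh_sub mT)]. Qed.

Lemma negligible_bigcup_ord (F : 'I_N -> set E) :
  (forall i, mu.-negligible (F i)) -> mu.-negligible (\bigcup_i F i).
Proof.
move=> nF; pose G k := if @insub _ _ 'I_N k is Some i then F i else set0.
apply: (negligibleS (A := \bigcup_k G k)).
  by move=> x [i _ Fx]; exists (val i) => //; rewrite /G valK.
by apply: negligible_bigcup => k; rewrite /G; case: insub => // ; exact: negligible_set0.
Qed.

(** A point of the domain lies in the closure of an element; when it lies in
    no element, it lies on the Lipschitz boundary of one. *)
Lemma skeleton_null : mu (Omega `\` elements) = 0%E.
Proof.
have mS : measurable (Omega `\` elements).
  by apply: measurableD; [exact: measurable_domain|exact: measurable_elements].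
apply/negligibleP => //.
apply: (negligibleS (A := \bigcup_i (closure (T i) `\` T i))).
  move=> x [Ox nT].
  have : closure Omega x by exact: subset_closure.
  rewrite (mesh_cover mT) => -[i _ cTi]; exists i => //; split=> // Tx.
  by apply: nT; exists i.
apply: negligible_bigcup_ord => i; have [oT _ _ lT] := mesh_lipschitz mT i.
by apply: lipschitz_boundary_null => //; exact: bounded_element.
Qed.

Lemma ip_mesh f g : L2 Omega f -> L2 Omega g -> ip Omega f g = \sum_i ip (T i) f g.
Proof.
move=> Lf Lg; have mO := measurable_domain.
have I := L2_integrableM mO Lf Lg.
have mE := measurable_elements.
have := negligible_integral (measurableD mO mE) mO I skeleton_null.
rewrite setDD setIidr; last exact: elements_sub.
rewrite /ip /Rintegral => ->.
have eE : elements = \big[setU/set0]_(i <- index_enum 'I_N) T i.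
  rewrite -bigcup_seq; apply/seteqP; split=> x [i _ Tx]; exists i => //=.
  by rewrite mem_index_enum.
rewrite eE integral_bigsetU_EFin//; last 4 first.
- by move=> i; exact: measurable_element.
- exact: index_enum_uniq.
- exact: (sub_trivIset (@subsetT _ _) (mesh_disjoint mT)).
- by rewrite -eE; apply: measurable_funS (measurable_int mu I) => //; exact: elements_sub.
rewrite -sum_fine// => i _; have mi := measurable_element i.
exact: (integrable_fin_num mi (integrableS mO mi (mesh_sub mT (i := i)) I)).
Qed.

Lemma L2_element i f : L2 Omega f -> L2 (T i) f.
Proof.
move=> Lf; have mO := measurable_domain; have mi := measurable_element i.
split; first exact: measurable_funS mO (mesh_sub mT (i := i)) (L2_measurable Lf).
have /integrableP[_] := integrableS mO mi (mesh_sub mT (i := i)) (L2_integrable_sqr Lf).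
by under eq_integral do rewrite /= ger0_norm ?sqr_ge0//.
Qed.

Lemma vL2_element i (f : E -> E) : vL2 Omega f -> vL2 (T i) f.
Proof. by move=> Lf j; exact: L2_element. Qed.

Lemma vip_mesh f g : vL2 Omega f -> vL2 Omega g -> vip Omega f g = \sum_i vip (T i) f g.
Proof.
move=> Lf Lg; rewrite (vipE measurable_domain)//.
under eq_bigr => j _ do rewrite (ip_mesh (Lf j) (Lg j)).
rewrite exchange_big; apply: eq_bigr => i _.
by rewrite (vipE (measurable_element i))//; exact: vL2_element.
Qed.

Lemma H1_element i v : H1 Omega v -> H1 (T i) v.
Proof.
case=> L1 L2 H; split; [exact: L2_element|exact: vL2_element|move=> phi cphi j].
have TO := mesh_sub mT (i := i).
rewrite (ip_vanish _ TO) ?(ip_vanish _ TO);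
  [|exact: Cc_smooth_out cphi|exact: Cc_partial_out cphi j].
by apply: H; exact: Cc_smooth_sub cphi.
Qed.

Lemma Hdiv_element i tau : Hdiv Omega tau -> Hdiv (T i) tau.
Proof.
case=> L1 L2 H; split; [exact: vL2_element|exact: L2_element|move=> phi cphi].
have TO := mesh_sub mT (i := i).
rewrite (vipE (measurable_element i));
  [|exact: vL2_element|exact: (Cc_grad_vL2 cphi (measurable_element i))].
have cO := Cc_smooth_sub TO cphi.
rewrite (ip_vanish _ TO); last exact: Cc_smooth_out cphi.
rewrite -H// (vipE measurable_domain)//; last exact: (Cc_grad_vL2 cO measurable_domain).
apply: eq_bigr => j _; rewrite coordf_grad; apply: ip_vanish => //.
exact: Cc_partial_out cphi j.
Qed.

(** Elements are pairwise disjoint, so at most one summand is nonzero at each point;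
    outside of the elements, that is almost nowhere, the value is 0. *)
Definition glue (V : nmodType) (g : 'I_N -> E -> V) : E -> V :=
  fun x => \sum_i (if x \in T i then g i x else 0).

Lemma glueE (V : nmodType) (g : 'I_N -> E -> V) i x : T i x -> glue g x = g i x.
Proof.
move=> Tx; rewrite /glue (bigD1 i)//= mem_set// big1 ?addr0// => j ji.
rewrite memNset// => Tj; have := mesh_disjoint mT => /trivIsetP/(_ i j I I).
by rewrite eq_sym ji => /(_ isT); rewrite -subset0 => /(_ x); apply.
Qed.

Lemma eq_ip (omega : set E) (f f' g g' : E -> R) : {in omega, f =1 f'} -> {in omega, g =1 g'} ->
  ip omega f g = ip omega f' g'.
Proof. by move=> ff gg; apply: eq_Rintegral => x xo; rewrite ff// gg. Qed.

Lemma eq_vip (omega : set E) (f f' g g' : E -> E) : {in omega, f =1 f'} ->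
  {in omega, g =1 g'} ->
  vip omega f g = vip omega f' g'.
Proof. by move=> ff gg; apply: eq_Rintegral => x xo; rewrite ff// gg. Qed.

Lemma L2_restrict i f : L2 (T i) f -> L2 Omega (fun x => if x \in T i then f x else 0).
Proof.
move=> Lf; have mO := measurable_domain; have mi := measurable_element i.
have e g : (fun x => if x \in T i then g x else 0) = g \_ (T i) :> (E -> R) by [].
split.
  rewrite e; apply/(measurable_restrict _ mi mO); rewrite setIidr; first exact: L2_measurable.
  exact: mesh_sub.
rewrite (eq_integral ((fun x => (f x ^+ 2)%:E) \_ (T i))); last first.
  by move=> x _; rewrite /restrict; case: ifP => //; rewrite expr0n.
rewrite -integral_mkcondr setIidr; last exact: mesh_sub.
by case: Lf.
Qed.

Lemma L2_glue (g : 'I_N -> E -> R) : (forall i, L2 (T i) (g i)) -> L2 Omega (glue g).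
Proof.
move=> Lg; rewrite /glue.
have -> : (fun x => \sum_i (if x \in T i then g i x else 0)) =
    \sum_i (fun x => if x \in T i then g i x else 0).
  by apply/funext => x; rewrite fct_sumE.
elim/big_ind: _ => [|a b La Lb|i _]; first exact: L20.
  exact: (prehilbertD (L2_prehilbert measurable_domain)).
exact: L2_restrict.
Qed.

Lemma vL2_glue (g : 'I_N -> E -> E) : (forall i, vL2 (T i) (g i)) -> vL2 Omega (glue g).
Proof.
move=> Lg j; rewrite (_ : (fun x => _) = glue (fun i => coordf j (g i))).
  by apply: L2_glue => i; exact: Lg.
apply/funext => x; rewrite /glue summxE; apply: eq_bigr => i _.
by case: ifP => //; rewrite mxE.
Qed.

End mesh_additivity.

(** * The bilinear form in terms of global functions *)

Section broken_formulation.
Variables (R : realType) (n : nat).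
Local Notation E := 'rV[R]_n.
Local Notation mu := (lebesgue_rV R n).
Variables (Omega : set E) (N : nat) (T : 'I_N -> set E).
Hypotheses (bO : bounded_set Omega) (lO : lipschitz_domain Omega) (mT : mesh Omega T).
Variable d : R.
Hypothesis d0 : 0 < d.

Let mO : measurable Omega := measurable_domain lO.
Let mE i : measurable (T i) := measurable_element mT i.
Let L2O := L2_prehilbert mO.
Let vL2O := vL2_prehilbert mO.
Let fH := form_H1_prehilbert mO d0.
Let fD := form_Hdiv_prehilbert mO d0.
Let dN0 : 0 < d ^- 2. Proof. by rewrite invr_gt0 exprn_gt0. Qed.
Let dP0 : 0 < d ^+ 2. Proof. exact: exprn_gt0. Qed.
Let dPN : d ^+ 2 * d ^- 2 = 1. Proof. by rewrite divff// gt_eqF. Qed.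
Let dNP : d ^- 2 * d ^+ 2 = 1. Proof. by rewrite mulVf// gt_eqF. Qed.

Implicit Types (v w : (E -> R) * (E -> E)) (tau rho : (E -> E) * (E -> R)).

(** For conforming arguments this is a boundary term; with a broken second argument
    it is the duality between traces and broken functions. *)
Definition pairing v tau : R := ip Omega v.1 tau.2 + vip Omega v.2 tau.1.

(** The weights of the two scaled forms are dual to each other: the pairing
    is the form of H^1 at v and (d^2 div tau, tau), and the square norm of the latter
    in H^1 is that of tau in H(div). *)
Lemma pairing_cauchy_schwarz v tau : L2grad Omega v -> L2div Omega tau ->
  pairing v tau ^+ 2 <= form_H1 d Omega v v * form_Hdiv d Omega tau tau.
Proof.
move=> Kv [Kt1 Kt2]; have [Kv1 Kv2] := Kv.
pose p := (d ^+ 2 *: tau.2, tau.1); have Kp : L2grad Omega p.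
  by split=> //; exact: (prehilbertZ L2O).
have -> : pairing v tau = form_H1 d Omega v p.
  rewrite /form_H1 /pair_form /= (formZr L2O _ Kt2 Kv1).
  by rewrite mulrA dNP !mul1r.
have -> : form_Hdiv d Omega tau tau = form_H1 d Omega p p.
  have K2 : L2 Omega (d ^+ 2 *: tau.2) by exact: (prehilbertZ L2O).
  rewrite /form_H1 /form_Hdiv /pair_form /= (formZr L2O _ Kt2 K2) (formZl L2O _ Kt2 Kt2).
  by rewrite [d ^- 2 * _]mulrA dNP !mul1r addrC.
exact: (form_cauchy_schwarz fH).
Qed.

Lemma pairing_bound v tau : L2grad Omega v -> L2div Omega tau ->
  `|pairing v tau| <= norm_H1 d Omega v * norm_Hdiv d Omega tau.
Proof.
move=> Kv Kt; rewrite -sqrtr_sqr.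
rewrite -[leRHS]ger0_norm ?mulr_ge0 ?sqrtr_ge0// -sqrtr_sqr ler_wsqrtr//.
by rewrite exprMn norm_H1_sqr norm_Hdiv_sqr pairing_cauchy_schwarz.
Qed.

Lemma H1_brokenP (x : H1_broken T) i : H1 (T i) (\val x i).
Proof. by have := set_mem (valP x); apply. Qed.
Lemma Hdiv_brokenP (x : Hdiv_broken T) i : Hdiv (T i) (\val x i).
Proof. by have := set_mem (valP x); apply. Qed.

Definition broken_H1 (v : 'I_N -> (E -> R) * (E -> E)) (Hv : H1_broken T v) : H1_broken T :=
  SigSub (mem_set Hv).
Definition broken_Hdiv (tau : 'I_N -> (E -> E) * (E ->
  R)) (Ht : Hdiv_broken T tau) : Hdiv_broken T :=
  SigSub (mem_set Ht).

Definition glue_H1 (x : H1_broken T) : (E -> R) * (E -> E) :=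
  (glue T (fun i => (\val x i).1), glue T (fun i => (\val x i).2)).
Definition glue_Hdiv (x : Hdiv_broken T) : (E -> E) * (E -> R) :=
  (glue T (fun i => (\val x i).1), glue T (fun i => (\val x i).2)).

Lemma glue_H1_L2grad x : L2grad Omega (glue_H1 x).
Proof.
split; first by apply: (L2_glue lO mT) => i; exact: (H1_L2grad (H1_brokenP x i)).1.
by apply: (vL2_glue lO mT) => i; exact: (H1_L2grad (H1_brokenP x i)).2.
Qed.

Lemma glue_Hdiv_L2div x : L2div Omega (glue_Hdiv x).
Proof.
split; first by apply: (vL2_glue lO mT) => i; exact: (Hdiv_L2div (Hdiv_brokenP x i)).1.
by apply: (L2_glue lO mT) => i; exact: (Hdiv_L2div (Hdiv_brokenP x i)).2.
Qed.

Lemma ip_glue f (g : 'I_N -> E -> R) : L2 Omega f -> (forall i, L2 (T i) (g i)) ->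
  ip Omega f (glue T g) = \sum_i ip (T i) f (g i).
Proof.
move=> Lf Lg; rewrite (ip_mesh bO lO mT Lf (L2_glue lO mT Lg)); apply: eq_bigr => i _.
by apply: eq_ip => // x /set_mem Tx; exact: (glueE mT).
Qed.

Lemma vip_glue (f : E -> E) (g : 'I_N -> E -> E) : vL2 Omega f -> (forall i, vL2 (T i) (g i)) ->
  vip Omega f (glue T g) = \sum_i vip (T i) f (g i).
Proof.
move=> Lf Lg; rewrite (vip_mesh bO lO mT Lf (vL2_glue lO mT Lg)); apply: eq_bigr => i _.
by apply: eq_vip => // x /set_mem Tx; exact: (glueE mT).
Qed.

Lemma ip_glue2 (f g : 'I_N -> E -> R) : (forall i, L2 (T i) (f i)) ->
  (forall i, L2 (T i) (g i)) ->
  ip Omega (glue T f) (glue T g) = \sum_i ip (T i) (f i) (g i).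
Proof.
move=> Lf Lg; rewrite (ip_mesh bO lO mT (L2_glue lO mT Lf) (L2_glue lO mT Lg)).
by apply: eq_bigr => i _; apply: eq_ip => // x /set_mem Tx; exact: (glueE mT).
Qed.

Lemma vip_glue2 (f g : 'I_N -> E -> E) : (forall i, vL2 (T i) (f i)) ->
  (forall i, vL2 (T i) (g i)) ->
  vip Omega (glue T f) (glue T g) = \sum_i vip (T i) (f i) (g i).
Proof.
move=> Lf Lg; rewrite (vip_mesh bO lO mT (vL2_glue lO mT Lf) (vL2_glue lO mT Lg)).
by apply: eq_bigr => i _; apply: eq_vip => // x /set_mem Tx; exact: (glueE mT).
Qed.

Let H1b1 (x : H1_broken T) i := (H1_L2grad (H1_brokenP x i)).1.
Let H1b2 (x : H1_broken T) i := (H1_L2grad (H1_brokenP x i)).2.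
Let Hdb1 (x : Hdiv_broken T) i := (Hdiv_L2div (Hdiv_brokenP x i)).1.
Let Hdb2 (x : Hdiv_broken T) i := (Hdiv_L2div (Hdiv_brokenP x i)).2.

Lemma tr_gradE v (x : Hdiv_broken T) : L2grad Omega v ->
  tr_grad (fun=> v) x = pairing v (glue_Hdiv x).
Proof.
move=> [L1 L2]; rewrite /tr_grad /pairing /glue_Hdiv /= (ip_glue L1 (Hdb2 x)) (vip_glue L2
  (Hdb1 x)).
by rewrite big_split.
Qed.

Lemma tr_divE tau (x : H1_broken T) : L2div Omega tau ->
  tr_div (fun=> tau) x = pairing (glue_H1 x) tau.
Proof.
move=> Kt; have [L1 L2] := Kt; have [G1 G2] := glue_H1_L2grad x.
rewrite /pairing (formC L2O G1 L2) (formC vL2O G2 L1).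
rewrite /tr_div /glue_H1 /= (ip_glue L2 (H1b1 x)) (vip_glue L1 (H1b2 x)).
by rewrite big_split addrC.
Qed.

(** A function on the domain seen as a broken one is constant in the element index. *)
Definition conforming_Hdiv tau (Ht : Hdiv Omega tau) : Hdiv_broken T :=
  broken_Hdiv (fun i => Hdiv_element lO mT i Ht).
Definition conforming_H1 v (Hv : H1 Omega v) : H1_broken T :=
  broken_H1 (fun i => H1_element lO mT i Hv).

Lemma tr_grad_conf v tau (Ht : Hdiv Omega tau) : L2grad Omega v ->
  tr_grad (fun=> v) (conforming_Hdiv Ht) = pairing v tau.
Proof.
move=> [L1 L2]; have [K1 K2] := Hdiv_L2div Ht.
by rewrite /tr_grad /pairing (ip_mesh bO lO mT L1 K2) (vip_mesh bO lO mT L2 K1) big_split.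
Qed.

Lemma tr_div_conf tau v (Hv : H1 Omega v) : L2div Omega tau ->
  tr_div (fun=> tau) (conforming_H1 Hv) = pairing v tau.
Proof.
move=> [L1 L2]; have [K1 K2] := H1_L2grad Hv.
rewrite /pairing (formC L2O K1 L2) (formC vL2O K2 L1).
by rewrite /tr_div (ip_mesh bO lO mT L2 K1) (vip_mesh bO lO mT L1 K2) big_split addrC.
Qed.

(** Gluing is an isometry from the broken test space to pairs of global L_2
    functions, which moves all estimates to the domain. *)
Lemma ip_VE (z y : test T) :
  ip_V d z y = form_H1 d Omega (glue_H1 z.1) (glue_H1 y.1) + form_Hdiv d Omega (glue_Hdiv
    z.2) (glue_Hdiv y.2).
Proof.
rewrite /form_H1 /form_Hdiv /pair_form /glue_H1 /glue_Hdiv /=.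
rewrite (ip_glue2 (H1b1 _) (H1b1 _)) (vip_glue2 (H1b2 _) (H1b2 _)).
rewrite (ip_glue2 (Hdb2 _) (Hdb2 _)) (vip_glue2 (Hdb1 _) (Hdb1 _)).
rewrite /ip_V !mul1r !mulr_sumr -!big_split; apply: eq_bigr => i _ /=.
by rewrite !addrA.
Qed.

(** The volume terms without the gradient of v form a pairing with the trial
    variables (u, sigma), seen as a function and its gradient. *)
Lemma bformE (u : trial T) (y : test T) : L2 Omega (fld u) -> vL2 Omega (flux u) ->
  bform u y = pairing (fld u, flux u) (glue_Hdiv y.2) + vip Omega (flux u) (glue_H1 y.1).2
    - fld_trace u y.2 - flux_trace u y.1.
Proof.
move=> Lu Ls; rewrite /bform /pairing /glue_H1 /glue_Hdiv /=.
rewrite (ip_glue Lu (Hdb2 _)) (vip_glue Ls (Hdb1 _)) (vip_glue Ls (H1b2 _)).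
congr (_ - _ - _); rewrite -addrA; congr (_ + _); rewrite -big_split; apply: eq_bigr => i _ /=.
have Li := vL2_element lO mT i Ls.
by rewrite -(formDr (vL2_prehilbert (mE i)) (Hdb1 y.2 i) (H1b2 y.1 i) Li).
Qed.

Lemma bformB (u1 u2 : trial T) y : U_space Omega u1 -> U_space Omega u2 ->
  bform (u1 - u2) y = bform u1 y - bform u2 y.
Proof.
move=> [a1 b1 _ _] [a2 b2 _ _].
have a3 : L2 Omega (fld (u1 - u2)) by exact: (prehilbertB L2O).
have b3 : vL2 Omega (flux (u1 - u2)) by exact: (prehilbertB vL2O).
rewrite !bformE//.
have [K1 K2] := glue_Hdiv_L2div y.2; have [K3 K4] := glue_H1_L2grad y.1.
have -> : pairing (fld (u1 - u2), flux (u1 - u2)) (glue_Hdiv y.2) =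
   pairing (fld u1, flux u1) (glue_Hdiv y.2) - pairing (fld u2, flux u2) (glue_Hdiv y.2).
  by rewrite /pairing /= (formBl L2O a1 a2 K2) (formBl vL2O b1 b2 K1); ring.
rewrite (formBl vL2O b1 b2 K4).
have -> : fld_trace (u1 - u2) y.2 = fld_trace u1 y.2 - fld_trace u2 y.2 by [].
have -> : flux_trace (u1 - u2) y.1 = flux_trace u1 y.1 - flux_trace u2 y.1 by [].
ring.
Qed.

Lemma H12_00_sub a b : H12_00 Omega a -> H12_00 Omega b -> H12_00 (T := T) Omega (a - b).
Proof.
move=> [p Hp <-] [q Hq <-]; exists (p - q).
  by have := H10_lin mO (-1) Hq Hp; rewrite scaleN1r addrC.
apply/funext => x; rewrite tr_gradE;
  last exact: (prehilbertB fH (H10_L2grad Hp) (H10_L2grad Hq)).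
rewrite [RHS](_ : _ = tr_grad (fun=> p) x - tr_grad (fun=> q) x)//.
rewrite !tr_gradE; [|exact: H10_L2grad|exact: H10_L2grad].
have [K1 K2] := glue_Hdiv_L2div x; have [P1 P2] := H10_L2grad Hp; have [Q1 Q2] := H10_L2grad Hq.
by rewrite /pairing /= (formBl L2O P1 Q1 K2) (formBl vL2O P2 Q2 K1); ring.
Qed.

Lemma Hm12_sub a b : Hm12 Omega a -> Hm12 Omega b -> Hm12 (T := T) Omega (a - b).
Proof.
move=> [p Hp <-] [q Hq <-]; exists (p - q).
  by have := Hdiv_lin mO d0 (-1) Hq Hp; rewrite scaleN1r addrC.
have P := Hdiv_L2div Hp; have Q := Hdiv_L2div Hq.
apply/funext => x; rewrite tr_divE; last exact: (prehilbertB fD P Q).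
rewrite [RHS](_ : _ = tr_div (fun=> p) x - tr_div (fun=> q) x)//.
rewrite !tr_divE//.
have [K1 K2] := glue_H1_L2grad x; have [P1 P2] := P; have [Q1 Q2] := Q.
by rewrite /pairing /= (formBr L2O P2 Q2 K1) (formBr vL2O P1 Q1 K2); ring.
Qed.

Lemma U_space_sub (u1 u2 : trial T) : U_space Omega u1 -> U_space Omega u2 ->
  U_space Omega (u1 - u2).
Proof.
move=> [a1 b1 c1 e1] [a2 b2 c2 e2]; split.
- exact: (prehilbertB L2O).
- exact: (prehilbertB vL2O).
- exact: H12_00_sub.
- exact: Hm12_sub.
Qed.

Lemma fin_dim_sub (Uh : set (trial T)) (w1 w2 : trial T) : fin_dim_subspace Omega Uh ->
  Uh w1 -> Uh w2 -> Uh (w1 - w2).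
Proof.
move=> [m [e [Ue ->]]] [U1 [c1 [f1 g1 h1 k1]]] [U2 [c2 [f2 g2 h2 k2]]].
split; first exact: U_space_sub.
exists (fun j => c1 j - c2 j).
have -> : \sum_j (c1 j - c2 j) *: e j = \sum_j c1 j *: e j - \sum_j c2 j *: e j :> trial T.
  by rewrite -sumrB; apply: eq_bigr => j _; rewrite scalerBl.
set s1 := \sum_j c1 j *: e j in f1 g1 h1 k1 *; set s2 := \sum_j c2 j *: e j in f2 g2 h2 k2 *.
clearbody s1 s2.
split.
- apply: filterS2 f1 f2 => x e1 e2 Ox.
  by rewrite (_ : fld (w1 - w2) x = fld w1 x - fld w2 x)// e1// e2.
- apply: filterS2 g1 g2 => x e1 e2 Ox.
  by rewrite (_ : flux (w1 - w2) x = flux w1 x - flux w2 x)// e1// e2.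
- by rewrite (_ : fld_trace (w1 - w2) = fld_trace w1 - fld_trace w2)// h1 h2.
- by rewrite (_ : flux_trace (w1 - w2) = flux_trace w1 - flux_trace w2)// k1 k2.
Qed.

Arguments glue_H1 : simpl never.
Arguments glue_Hdiv : simpl never.

(** * The trial-to-test operator and the conforming reconstruction *)

Lemma H1_broken0 : H1_broken T (fun=> 0).
Proof.
move=> i; have := Cc_H1 (mE i) (@Cc_smooth0 R n (T i)); congr H1; congr pair.
by apply/funext => x; apply/rowP => j; rewrite !mxE /partial derive_cst.
Qed.

Lemma Hdiv_broken0 : Hdiv_broken T (fun=> 0).
Proof.
move=> i; rewrite (Hdiv_orth (mE i) d0); split=> [|p Hp].
  exact: (prehilbert0 (form_Hdiv_prehilbert (mE i) d0)).
apply: (form0l (form_Hdiv_prehilbert (mE i) d0)); exact: (Hdiv_tests_sub (mE i) Hp).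
Qed.

Lemma glue0 (V : nmodType) (g : 'I_N -> E -> V) : (forall i x, g i x = 0) -> glue T g = fun=> 0.
Proof.
by move=> g0; apply/funext => x; rewrite /glue big1// => i _; rewrite g0; case: ifP.
Qed.

Lemma glue_H1_0 : glue_H1 (broken_H1 H1_broken0) = 0.
Proof. by rewrite /glue_H1 !glue0. Qed.

Lemma glue_Hdiv_0 : glue_Hdiv (broken_Hdiv Hdiv_broken0) = 0.
Proof. by rewrite /glue_Hdiv !glue0. Qed.

Lemma pairing0l tau : L2div Omega tau -> pairing 0 tau = 0.
Proof. by move=> [K1 K2]; rewrite /pairing /= (form0l L2O K2) (form0l vL2O K1) addr0. Qed.

Lemma pairing0r v : L2grad Omega v -> pairing v 0 = 0.
Proof.
move=> [K1 K2]; rewrite /pairing /= (formC L2O K1 (prehilbert0 L2O)) (formC vL2O K2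
  (prehilbert0 vL2O)).
by rewrite (form0l L2O K1) (form0l vL2O K2) addr0.
Qed.

(** The trace terms are L_2 products with representatives p and q of the two
    traces, so that on each element the functional b(u, .) is the inner product with a
    pair of L_2 functions, separately in v and in tau. Its representatives are the
    projections of these pairs on H^1(T) and H(div, T). *)
Lemma theta_exists (u : trial T) : U_space Omega u -> exists z : test T, is_Theta d u z.
Proof.
move=> [Lu Ls [p Hp pu] [q Hq qs]].
have [P1 P2] := H10_L2grad Hp; have [Q1 Q2] := Hdiv_L2div Hq.
have r1 i : L2grad (T i) (- d ^+ 2 *: q.2, flux u - q.1).
  split; first by apply: (prehilbertZ (L2_prehilbert (mE i))); exact: (L2_element lO mT).
  by apply: (prehilbertB (vL2_prehilbert (mE i))); exact: (vL2_element lO mT).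
have r2 i : L2div (T i) (flux u - p.2, d ^- 2 *: (fld u - p.1)).
  split; first by apply: (prehilbertB (vL2_prehilbert (mE i))); exact: (vL2_element lO mT).
  by apply: (prehilbertZ (L2_prehilbert (mE i)));
    apply: (prehilbertB (L2_prehilbert (mE i))); exact: (L2_element lO mT).
have /choice[vz vzP] i : exists z, H1 (T i) z /\ forall x, H1 (T i) x ->
    form_H1 d (T i) ((- d ^+ 2 *: q.2, flux u - q.1) - z) x = 0.
  by have [z Hz Oz] := H1_projection (mE i) d0 (r1 i); exists z.
have /choice[tz tzP] i : exists z, Hdiv (T i) z /\ forall x, Hdiv (T i) x ->
    form_Hdiv d (T i) ((flux u - p.2, d ^- 2 *: (fld u - p.1)) - z) x = 0.
  by have [z Hz Oz] := Hdiv_projection (mE i) d0 (r2 i); exists z.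
exists (broken_H1 (fun i => (vzP i).1), broken_Hdiv (fun i => (tzP i).1)) => y.
rewrite (bformE y Lu Ls) -pu -qs (tr_gradE _ (H10_L2grad Hp)) (tr_divE _ (Hdiv_L2div Hq)).
rewrite /pairing /glue_H1 /glue_Hdiv /=.
pose x1 i := H1_brokenP y.1 i; pose x2 i := Hdiv_brokenP y.2 i.
pose L1 i : L2 (T i) (\val y.1 i).1 := (H1_L2grad (x1 i)).1.
pose L2' i : vL2 (T i) (\val y.1 i).2 := (H1_L2grad (x1 i)).2.
pose L3 i : vL2 (T i) (\val y.2 i).1 := (Hdiv_L2div (x2 i)).1.
pose L4 i : L2 (T i) (\val y.2 i).2 := (Hdiv_L2div (x2 i)).2.
rewrite (ip_glue Lu L4) (vip_glue Ls L3) (vip_glue Ls L2').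
rewrite (ip_glue P1 L4) (vip_glue P2 L3).
rewrite (formC L2O (L2_glue lO mT L1) Q2) (formC vL2O (vL2_glue lO mT L2') Q1).
rewrite (ip_glue Q2 L1) (vip_glue Q1 L2').
rewrite -!big_split -!sumrB; apply: eq_bigr => i _ /=.
have A := (vzP i).2 _ (x1 i); have B := (tzP i).2 _ (x2 i).
have FH := form_H1_prehilbert (mE i) d0; have FD := form_Hdiv_prehilbert (mE i) d0.
move: A; rewrite (formBl FH (r1 i) (H1_L2grad (vzP i).1) (H1_L2grad (x1 i))) => /eqP;
  rewrite subr_eq0 => /eqP.
move: B; rewrite (formBl FD (r2 i) (Hdiv_L2div (tzP i).1) (Hdiv_L2div (x2 i))) => /eqP;
  rewrite subr_eq0 => /eqP.
have a1 := L2_element lO mT i Lu; have a2 := vL2_element lO mT i Ls.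
have a3 := L2_element lO mT i P1; have a4 := vL2_element lO mT i P2.
have a5 := vL2_element lO mT i Q1; have a6 := L2_element lO mT i Q2.
have hL := L2_prehilbert (mE i); have hV := vL2_prehilbert (mE i).
rewrite /form_H1 /form_Hdiv /pair_form /= !mul1r.
rewrite (formZl hL _ a6 (L1 i)) (formBl hV a2 a5 (L2' i)) (formBl hV a2 a4 (L3 i)).
rewrite (formZl hL _ (prehilbertB hL a1 a3) (L4 i)) (formBl hL a1 a3 (L4 i)).
rewrite mulNr mulrN [d ^- 2 * (d ^+ 2 * _)]mulrA dNP mul1r.
rewrite [d ^+ 2 * (d ^- 2 * _)]mulrA dPN mul1r => e1 e2.
move: e1 e2; lra.
Qed.

Section reconstruction.
Variables (u : trial T) (z : test T).
Hypotheses (Uu : U_space Omega u) (zu : is_Theta d u z).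

Let V := glue_H1 z.1.
Let W := glue_Hdiv z.2.
Let KV : L2grad Omega V := glue_H1_L2grad z.1.
Let KW : L2div Omega W := glue_Hdiv_L2div z.2.
Let Lu : L2 Omega (fld u). Proof. by case: Uu. Qed.
Let Ls : vL2 Omega (flux u). Proof. by case: Uu. Qed.

(** With W the flux part of Theta u: the equations of Theta u with v = 0 say that
    this function has the trace of u. The second component is its gradient by
    [potential_H1]. *)
Definition potential : (E -> R) * (E -> E) := (fld u - d ^+ 2 *: W.2, flux u - W.1).

(** With V the scalar part of Theta u: the equations of Theta u with tau = 0
    say that this field has the normal trace of u. The second component is its
    divergence by [conforming_flux_Hdiv]. *)
Definition conforming_flux : (E -> E) * (E -> R) := (flux u - V.2, - d ^- 2 *: V.1).

Lemma potential_L2grad : L2grad Omega potential.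
Proof.
have [W1 W2] := KW; split; last exact: (prehilbertB vL2O).
by apply: (prehilbertB L2O) => //; exact: (prehilbertZ L2O).
Qed.

Lemma conforming_flux_L2div : L2div Omega conforming_flux.
Proof. by have [V1 V2] := KV; split; [exact: (prehilbertB vL2O)|exact: (prehilbertZ L2O)]. Qed.

(** This is the definition of Theta u, tested with (0, x). *)
Lemma tr_grad_potential : tr_grad (fun=> potential) = fld_trace u.
Proof.
apply/funext => x; rewrite tr_gradE; last exact: potential_L2grad.
have := zu (broken_H1 H1_broken0, x).
have KX := glue_Hdiv_L2div x; have [X1 X2] := KX; have [W1 W2] := KW; have [V1 V2] := KV.
rewrite ip_VE bformE //= glue_H1_0 (formC fH KV (prehilbert0 fH)) (form0l fH KV) add0r.
have -> : flux_trace u (broken_H1 H1_broken0) = 0.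
  case: Uu => _ _ _ [q Hq <-]; rewrite tr_divE; last exact: Hdiv_L2div.
  by rewrite glue_H1_0 pairing0l//; exact: Hdiv_L2div.
rewrite subr0 [vip Omega (flux u) _](_ : _ = 0) ?addr0; last first.
  rewrite (_ : glue T _ = 0); last exact: glue0.
  by rewrite (formC vL2O Ls (prehilbert0 vL2O)) (form0l vL2O Ls).
rewrite /pairing /form_Hdiv /pair_form /= mul1r -/W.
rewrite (formBl L2O Lu (prehilbertZ L2O _ W2) X2) (formZl L2O _ W2 X2) (formBl vL2O Ls W1 X1).
move=> /eqP; rewrite eq_sym subr_eq => /eqP; lra.
Qed.

(** This is the definition of Theta u, tested with (x, 0). *)
Lemma tr_div_conforming_flux : tr_div (fun=> conforming_flux) = flux_trace u.
Proof.
apply/funext => x; rewrite tr_divE; last exact: conforming_flux_L2div.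
have := zu (x, broken_Hdiv Hdiv_broken0).
have KX := glue_H1_L2grad x; have [X1 X2] := KX; have [W1 W2] := KW; have [V1 V2] := KV.
rewrite ip_VE bformE //= glue_Hdiv_0 (formC fD KW (prehilbert0 fD)) (form0l fD KW) addr0.
have -> : fld_trace u (broken_Hdiv Hdiv_broken0) = 0.
  case: Uu => _ _ [q Hq <-] _; rewrite tr_gradE; last exact: H10_L2grad.
  by rewrite glue_Hdiv_0 pairing0r//; exact: H10_L2grad.
rewrite subr0 pairing0r ?add0r; last by split.
rewrite /pairing /form_H1 /pair_form /= mul1r -/V.
rewrite (formZr L2O _ V1 X1) (formBr vL2O Ls V2 X2) (formC L2O V1 X1) (formC vL2O Ls X2)
  (formC vL2O V2 X2).
move=> /eqP; rewrite eq_sym subr_eq => /eqP; lra.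
Qed.

Lemma fld_trace_conf rho (Hr : Hdiv Omega rho) : fld_trace u (conforming_Hdiv Hr) = 0.
Proof.
case: Uu => _ _ [p Hp <-] _; rewrite tr_grad_conf; last exact: H10_L2grad.
exact: (H10_Hdiv_orth mO).
Qed.

(** The potential has the same trace as an element of H^1_0. *)
Lemma potential_Hdiv_orth rho : Hdiv Omega rho -> pairing potential rho = 0.
Proof.
move=> Hr; rewrite -(tr_grad_conf Hr potential_L2grad).
by rewrite tr_grad_potential fld_trace_conf.
Qed.

(** Orthogonality to the conforming fields phi e_i is the definition of the weak
    gradient. *)
Lemma potential_H1 : H1 Omega potential.
Proof.
have [K1 K2] := potential_L2grad; split=> // phi cphi i.
have := potential_Hdiv_orth (Cc_Hdiv mO i cphi); rewrite /pairing.
rewrite vip_axis//; last exact: (Cc_smooth_L2 cphi mO).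
by move=> /eqP; rewrite addr_eq0 => /eqP.
Qed.

Lemma conforming_flux_Hdiv : Hdiv Omega conforming_flux.
Proof.
have [K1 K2] := conforming_flux_L2div; split=> // phi cphi.
have Hp := Cc_H10 mO cphi; have Kp := H10_L2grad Hp.
have := tr_div_conf (H10_H1 Hp) conforming_flux_L2div.
rewrite tr_div_conforming_flux; case: Uu => _ _ _ [q Hq <-].
rewrite (tr_div_conf _ (Hdiv_L2div Hq)).
have -> : pairing (phi, grad phi) q = 0 by exact: (H10_Hdiv_orth mO).
have [p1 p2] := Kp.
rewrite /pairing (formC L2O p1 K2) (formC vL2O p2 K1) => /esym/eqP.
by rewrite addrC addr_eq0 => /eqP.
Qed.

Hypothesis poincare : forall v, H10 Omega v -> norm2 Omega v.1 <= d * vnorm2 Omega v.2.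

(** Let y be the projection of the potential on H^1_0. The remainder r is
    orthogonal to test functions, so grad r is in H(div) with divergence d^-2 r.
    Both the potential and y pair to 0 with this flux, hence so does r; but the pairing
    of r with it is the square of the norm of r. *)
Lemma potential_poincare : norm2 Omega potential.1 <= d * vnorm2 Omega potential.2.
Proof.
have Kp := potential_L2grad.
have [y Hy yP] := H10_projection mO d0 Kp; have Ky := H10_L2grad Hy.
pose r := potential - y; have Kr : L2grad Omega r by exact: (prehilbertB fH).
have [r1 r2] := Kr.
have Hr : Hdiv Omega (r.2, d ^- 2 *: r.1).
  split=> //=; first exact: (prehilbertZ L2O).
  move=> phi cphi; have := yP _ (Cc_H10 mO cphi).
  have Lp := Cc_smooth_L2 cphi mO.
  rewrite -/r /form_H1 /pair_form /= mul1r (formZl L2O _ r1 Lp) => /eqP.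
  by rewrite addrC addr_eq0 => /eqP.
have rr : form_H1 d Omega r r = 0.
  have h1 := potential_Hdiv_orth Hr; have h2 : pairing y _ = 0 := H10_Hdiv_orth mO Hy Hr.
  have h3 v : L2grad Omega v -> pairing v (r.2, d ^- 2 *: r.1) = form_H1 d Omega v r.
    by move=> [v1 v2]; rewrite /pairing /form_H1 /pair_form /= mul1r (formZr L2O _ r1 v1).
  by rewrite {1}/r (formBl fH Kp Ky Kr) -!h3// h1 h2 subr0.
have i1 := ip_ge0 Omega r.1; have i2 := vip_ge0 Omega r.2.
have [n1 n2] : norm2 Omega r.1 = 0 /\ vnorm2 Omega r.2 = 0.
  move: rr; rewrite /form_H1 /pair_form mul1r => e; have m := mulr_ge0 (ltW dN0) i1.
  have z1 : d ^- 2 * ip Omega r.1 r.1 = 0 by move: e m i2; lra.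
  have z2 : vip Omega r.2 r.2 = 0 by move: e m i2; lra.
  have /eqP z3 : ip Omega r.1 r.1 == 0.
    by move/eqP: z1; rewrite mulf_eq0 (gt_eqF dN0).
  by rewrite /norm2 /vnorm2 z2 z3 sqrtr0.
have [p1 p2] := Kp; have [y1 y2] := Ky.
have e1 : potential.1 = y.1 + r.1 by rewrite /r addrC subrK.
have e2 : y.2 = potential.2 + - r.2 by rewrite /r opprB addrC subrK.
have t1 : norm2 Omega potential.1 <= norm2 Omega y.1 + norm2 Omega r.1.
  by rewrite e1; exact: (form_triangle L2O).
have t2 : vnorm2 Omega y.2 <= vnorm2 Omega potential.2 + vnorm2 Omega r.2.
  rewrite e2 (_ : vnorm2 Omega r.2 = vnorm2 Omega (- r.2)).
    by apply: (form_triangle vL2O) => //; exact: (prehilbertN vL2O).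
  rewrite /vnorm2 (formNl vL2O r2 (prehilbertN vL2O r2)) (formC vL2O r2 (prehilbertN vL2O r2)).
  by rewrite (formNl vL2O r2 r2) opprK.
move: t1 t2; rewrite n1 n2 !addr0 => t1 t2.
apply: le_trans t1 _; apply: le_trans (poincare Hy) _.
exact: ler_wpM2l (ltW d0) _ _ t2.
Qed.

End reconstruction.

(** * Continuity, stability and quasi-optimality *)

Lemma norm2_ge0 f : 0 <= norm2 Omega f. Proof. exact: sqrtr_ge0. Qed.
Lemma vnorm2_ge0 f : 0 <= vnorm2 Omega f. Proof. exact: sqrtr_ge0. Qed.

Lemma norm2D f g : L2 Omega f -> L2 Omega g ->
  norm2 Omega (f + g) <= norm2 Omega f + norm2 Omega g.
Proof. by move=> ? ?; exact: (form_triangle L2O). Qed.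

Lemma vnorm2D f g : vL2 Omega f -> vL2 Omega g ->
  vnorm2 Omega (f + g) <= vnorm2 Omega f + vnorm2 Omega g.
Proof. by move=> ? ?; exact: (form_triangle vL2O). Qed.

Lemma norm2Z a f : L2 Omega f -> norm2 Omega (a *: f) = `|a| * norm2 Omega f.
Proof.
move=> Lf; have La := prehilbertZ L2O a Lf.
rewrite /norm2 (formZl L2O _ Lf La) (formZr L2O _ Lf Lf) mulrA -expr2 sqrtrM ?sqr_ge0//.
by rewrite sqrtr_sqr.
Qed.

Lemma vnorm2N f : vL2 Omega f -> vnorm2 Omega (- f) = vnorm2 Omega f.
Proof.
move=> Lf; have Ln := prehilbertN vL2O Lf.
by rewrite /vnorm2 (formNl vL2O Lf Ln) (formC vL2O Lf Ln) (formNl vL2O Lf Lf) opprK.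
Qed.

Lemma sqr_homo (b c : R) : 0 <= b -> b <= c -> b ^+ 2 <= c ^+ 2.
Proof. by move=> b0 bc; rewrite ler_pXn2r// nnegrE ?(le_trans b0). Qed.

(** Here m, g, t, D are the scaled norms of v, grad v, tau, div tau for
    (v, tau) = Theta u, and x is the norm of the gradient of the potential. Bounding x by
    m + g + t leaves sums of squares of linear forms in m, g, t, D, whose squared
    coefficient vectors have total 4 + 6 + 2 * 3 + 9 + 1 = 26. *)
Lemma energy_arith (m g t D x a s p q : R) : 0 <= m -> 0 <= g -> 0 <= t -> 0 <= D -> 0 <= x ->
  0 <= a -> 0 <= s ->
  x <= m + g + t -> a <= x + D -> s <= x + t -> p <= 2 * x ^+ 2 ->
    q <= (x + t + g) ^+ 2 + m ^+ 2 ->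
  a ^+ 2 + s ^+ 2 + p + q <= 26 * (m ^+ 2 + g ^+ 2 + t ^+ 2 + D ^+ 2).
Proof.
move=> m0 g0 t0 D0 x0 a0 s0 xle ale sle ple qle.
have h1 : a ^+ 2 <= (m + g + t + D) ^+ 2 by apply: sqr_homo => //; lra.
have h2 : s ^+ 2 <= (m + g + 2 * t) ^+ 2 by apply: sqr_homo => //; lra.
have h3 : x ^+ 2 <= (m + g + t) ^+ 2 by exact: sqr_homo.
have h4 : (x + t + g) ^+ 2 <= (m + 2 * g + 2 * t) ^+ 2 by apply: sqr_homo; lra.
(* the four squared coefficient vectors: (1,1,1,1), (1,1,2), (1,1,1), (1,2,2) *)
have c1 : (m + g + t + D) ^+ 2 <= 4 * (m ^+ 2 + g ^+ 2 + t ^+ 2 + D ^+ 2).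
  have := sqr_ge0 (m - g); have := sqr_ge0 (m - t); have := sqr_ge0 (m - D).
  have := sqr_ge0 (g - t); have := sqr_ge0 (g - D); have := sqr_ge0 (t - D); lra.
have c2 : (m + g + 2 * t) ^+ 2 <= 6 * (m ^+ 2 + g ^+ 2 + t ^+ 2).
  have := sqr_ge0 (m - g); have := sqr_ge0 (2 * m - t); have := sqr_ge0 (2 * g - t); lra.
have c3 : (m + g + t) ^+ 2 <= 3 * (m ^+ 2 + g ^+ 2 + t ^+ 2).
  have := sqr_ge0 (m - g); have := sqr_ge0 (m - t); have := sqr_ge0 (g - t); lra.
have c4 : (m + 2 * g + 2 * t) ^+ 2 <= 9 * (m ^+ 2 + g ^+ 2 + t ^+ 2).
  have := sqr_ge0 (2 * m - g); have := sqr_ge0 (2 * m - t);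
    have := sqr_ge0 (2 * g - 2 * t); lra.
have := sqr_ge0 D; have := sqr_ge0 g; have := sqr_ge0 t; have := sqr_ge0 m; lra.
Qed.

Lemma norm_H1_ge0 v : 0 <= norm_H1 d Omega v. Proof. exact: sqrtr_ge0. Qed.
Lemma norm_Hdiv_ge0 tau : 0 <= norm_Hdiv d Omega tau. Proof. exact: sqrtr_ge0. Qed.

Lemma norm_12_le uhat v : H1 Omega v -> tr_grad (T := T) (fun=> v) = uhat ->
  norm_12 d Omega uhat <= norm_H1 d Omega v.
Proof.
move=> Hv vu; apply: inf_lbound; last by exists v.
by exists 0 => _ [w _ <-]; exact: norm_H1_ge0.
Qed.

Lemma norm_m12_le shat tau : Hdiv Omega tau -> tr_div (T := T) (fun=> tau) = shat ->
  norm_m12 d Omega shat <= norm_Hdiv d Omega tau.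
Proof.
move=> Ht ts; apply: inf_lbound; last by exists tau.
by exists 0 => _ [w _ <-]; exact: norm_Hdiv_ge0.
Qed.

Lemma norm_12_ge0 (uhat : Hdiv_broken T -> R) : 0 <= norm_12 d Omega uhat.
Proof.
have [[a Sa]|S0] := pselect ([set norm_H1 d Omega v |
   v in [set v | H1 Omega v /\ tr_grad (T := T) (fun=> v) = uhat]] !=set0).
  by apply: lb_le_inf; [exists a|move=> _ [w _ <-]; exact: norm_H1_ge0].
by rewrite /norm_12 inf_out// => -[].
Qed.

Lemma norm_m12_ge0 (shat : H1_broken T -> R) : 0 <= norm_m12 d Omega shat.
Proof.
have [[a Sa]|S0] := pselect ([set norm_Hdiv d Omega v |
   v in [set v | Hdiv Omega v /\ tr_div (T := T) (fun=> v) = shat]] !=set0).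
  by apply: lb_le_inf; [exists a|move=> _ [w _ <-]; exact: norm_Hdiv_ge0].
by rewrite /norm_m12 inf_out// => -[].
Qed.

(** Passes a bound for all representatives of a trace to the quotient norm. *)
Lemma inf_mul_le (S : set R) (c X : R) : S !=set0 -> 0 <= X -> (forall P, S P -> c <= P * X) ->
  c <= inf S * X.
Proof.
move=> S0; rewrite le_eqVlt => /predU1P[<- H|X0 H].
  by have [P /H] := S0; rewrite !mulr0.
by rewrite -ler_pdivrMr//; apply: lb_le_inf => // P /H; rewrite ler_pdivrMr.
Qed.

Lemma norm_12_bound uhat x : H12_00 Omega uhat ->
  `|uhat x| <= norm_12 d Omega uhat * norm_Hdiv d Omega (glue_Hdiv x).
Proof.
move=> [p Hp pu]; apply: inf_mul_le; [|exact: norm_Hdiv_ge0|].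
  by exists (norm_H1 d Omega p), p => //; split=> //; exact: H10_H1.
move=> _ [w [Hw wu] <-]; rewrite -wu tr_gradE; last exact: H1_L2grad.
apply: (pairing_bound); [exact: H1_L2grad|exact: (glue_Hdiv_L2div)].
Qed.

Lemma norm_m12_bound shat x : Hm12 Omega shat ->
  `|shat x| <= norm_m12 d Omega shat * norm_H1 d Omega (glue_H1 x).
Proof.
move=> [p Hp pu]; apply: inf_mul_le; [|exact: norm_H1_ge0|].
  by exists (norm_Hdiv d Omega p), p.
move=> _ [w [Hw wu] <-]; rewrite -wu tr_divE 1?mulrC; last exact: Hdiv_L2div.
apply: (pairing_bound); [exact: (glue_H1_L2grad)|exact: Hdiv_L2div].
Qed.

Lemma norm_U_sqr (u : trial T) : norm_U d Omega u ^+ 2 =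
  d ^- 2 * norm2 Omega (fld u) ^+ 2 + vnorm2 Omega (flux u) ^+ 2 +
  norm_12 d Omega (fld_trace u) ^+ 2 + norm_m12 d Omega (flux_trace u) ^+ 2.
Proof.
rewrite [LHS]sqr_sqrtr//; do 3?apply: addr_ge0; try exact: sqr_ge0.
by apply: mulr_ge0; [exact: ltW|exact: sqr_ge0].
Qed.

(** With S, p, q the norms of (u, sigma), uhat, shat, and X, Y those of tau and v,
    the form is at most (S + p) X + (S + q) Y, and the square of the norm of the vector
    (S + p, S + q) is at most 3 (S^2 + p^2 + q^2). *)
Lemma bform_bounded (u : trial T) (z : test T) : U_space Omega u ->
  bform u z ^+ 2 <= 3 * norm_U d Omega u ^+ 2 * ip_V d z z.
Proof.
move=> Uu; have [Lu Ls Hu Hs] := Uu.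
rewrite (bformE z Lu Ls) ip_VE norm_U_sqr.
have KX := glue_Hdiv_L2div z.2; have KY := glue_H1_L2grad z.1.
have Ku : L2grad Omega (fld u, flux u) by [].
have b1 := pairing_bound Ku KX.
have b2 := form_cauchy_schwarz_sqrt vL2O Ls KY.2.
have b3 := norm_12_bound z.2 Hu; have b4 := norm_m12_bound z.1 Hs.
rewrite -norm_H1_sqr -norm_Hdiv_sqr.
have hS : norm_H1 d Omega (fld u, flux u) ^+ 2 =
    d ^- 2 * norm2 Omega (fld u) ^+ 2 + vnorm2 Omega (flux u) ^+ 2.
  by rewrite norm_H1_sqr norm2_sqr vnorm2_sqr /form_H1 /pair_form mul1r.
have hs : vnorm2 Omega (flux u) <= norm_H1 d Omega (fld u, flux u).
  rewrite -(ler_pXn2r (n := 2))// ?nnegrE ?vnorm2_ge0 ?norm_H1_ge0// hS lerDr.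
  by apply: mulr_ge0; [exact: ltW|exact: sqr_ge0].
have hY : vnorm2 Omega (glue_H1 z.1).2 <= norm_H1 d Omega (glue_H1 z.1).
  rewrite -(ler_pXn2r (n := 2))// ?nnegrE ?vnorm2_ge0 ?norm_H1_ge0//.
  rewrite norm_H1_sqr vnorm2_sqr /form_H1 /pair_form mul1r lerDr.
  by apply: mulr_ge0; [exact: ltW|exact: ip_ge0].
rewrite -hS; move: b1 b2 b3 b4 hs hY.
rewrite -/(vnorm2 _ _) -/(vnorm2 _ _).
have := vnorm2_ge0 (flux u); have := norm_H1_ge0 (fld u, flux u).
have := norm_H1_ge0 (glue_H1 z.1); have := norm_Hdiv_ge0 (glue_Hdiv z.2).
have := norm_12_ge0 (fld_trace u); have := norm_m12_ge0 (flux_trace u).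
have := vnorm2_ge0 (glue_H1 z.1).2.
move: (norm_12 d Omega (fld_trace u)) (norm_m12 d Omega (flux_trace u)) (norm_H1 d Omega
  (glue_H1 z.1))
  (norm_Hdiv d Omega (glue_Hdiv z.2)) (norm_H1 d Omega (fld u, flux u)) (vnorm2 Omega (flux u))
  (vnorm2 Omega (glue_H1 z.1).2) (pairing (fld u,
    flux u) (glue_Hdiv z.2)) (vip Omega (flux u) (glue_H1 z.1).2)
  (fld_trace u z.2) (flux_trace u z.1).
move=> p q Y X S s y A B C D y0 q0 p0 X0 Y0 S0 s0 hA hB hC hD sS yY.
have hB' : `|B| <= S * Y.
  by apply: le_trans hB _; apply: ler_pM.
have hle : `|A + B - C - D| <= (S + p) * X + (S + q) * Y.
  have := ler_normB (A + B - C) D; have := ler_normB (A + B) C; have := ler_normD A B; lra.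
have : (A + B - C - D) ^+ 2 <= ((S + p) * X + (S + q) * Y) ^+ 2.
  rewrite -(real_normK (num_real _)) ler_pXn2r// nnegrE.
  by rewrite addr_ge0// mulr_ge0// addr_ge0.
move/le_trans; apply.
have h1 : ((S + p) * X + (S + q) * Y) ^+ 2 <= ((S + p) ^+ 2 + (S + q) ^+ 2) * (X ^+ 2 + Y ^+ 2).
  by have := sqr_ge0 ((S + p) * Y - (S + q) * X); lra.
have h2 : (S + p) ^+ 2 + (S + q) ^+ 2 <= 3 * (S ^+ 2 + p ^+ 2 + q ^+ 2).
  by have := sqr_ge0 (S - p - q); have := sqr_ge0 (p - q); lra.
apply: le_trans h1 _; rewrite [X ^+ 2 + _]addrC.
by apply: ler_wpM2r => //; rewrite addr_ge0 ?sqr_ge0.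
Qed.

Section stability.
Variables (u : trial T) (z : test T).
Hypotheses (Uu : U_space Omega u) (zu : is_Theta d u z).
Hypothesis poincare : forall v, H10 Omega v -> norm2 Omega v.1 <= d * vnorm2 Omega v.2.

(** The pairing of the potential with the conforming flux vanishes; expanding
    it bounds the gradient x of the potential, the rest being triangle inequalities. *)
Lemma stability : norm_U d Omega u ^+ 2 <= 26 * ip_V d z z.
Proof.
have [Lu Ls _ _] := Uu.
have KV := glue_H1_L2grad z.1; have KW := glue_Hdiv_L2div z.2.
have [V1 V2] := KV; have [W1 W2] := KW.
pose V := glue_H1 z.1; pose W := glue_Hdiv z.2.
pose pot := potential u z; pose cf := conforming_flux u z.
have Hpot : H1 Omega pot := potential_H1 Uu zu.
have Hcf : Hdiv Omega cf := conforming_flux_Hdiv Uu zu.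
have y_le := potential_poincare Uu zu poincare.
have pc0 := potential_Hdiv_orth Uu zu Hcf.
have [p1 p2] := H1_L2grad Hpot.
pose x := vnorm2 Omega pot.2; pose m := d^-1 * norm2 Omega V.1; pose g := vnorm2 Omega V.2.
pose t := vnorm2 Omega W.1; pose D := d * norm2 Omega W.2.
have m0 : 0 <= m by rewrite mulr_ge0 ?norm2_ge0// invr_ge0 ltW.
have D0 : 0 <= D by rewrite mulr_ge0 ?norm2_ge0// ltW.
have efl : flux u = pot.2 + W.1 by rewrite /pot /= subrK.
have efd : fld u = pot.1 + d ^+ 2 *: W.2 by rewrite /pot /= subrK.
have nV1 : norm2 Omega V.1 = d * m by rewrite /m mulrA divff ?mul1r// gt_eqF.
have x0 : 0 <= x by exact: vnorm2_ge0.
have xx : vip Omega pot.2 pot.2 = x ^+ 2 by rewrite -vnorm2_sqr.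
have xle : x <= m + g + t.
  have : x ^+ 2 <= x * (m + g + t).
    have LW : L2 Omega (- d ^- 2 *: V.1) by exact: (prehilbertZ L2O).
    have b1 : `|vip Omega pot.2 V.2| <= x * g by exact: (form_cauchy_schwarz_sqrt vL2O).
    have b2 : `|vip Omega pot.2 W.1| <= x * t by exact: (form_cauchy_schwarz_sqrt vL2O).
    have b3 : `|ip Omega pot.1 V.1| <= (d * x) * (d * m).
      apply: le_trans (form_cauchy_schwarz_sqrt L2O p1 V1) _; rewrite -nV1.
      by apply: ler_wpM2r; [exact: norm2_ge0|exact: y_le].
    have b3' : `|d ^- 2 * ip Omega pot.1 V.1| <= x * m.
      rewrite normrM gtr0_norm// -ler_pdivlMl// invrK; apply: le_trans b3 _.
      by rewrite le_eqVlt; apply/orP; left; apply/eqP; ring.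
    move: pc0; rewrite -/pot -/cf /pairing /cf /= (formZr L2O _ V1 p1).
    rewrite (formBr vL2O Ls V2 p2) {1}efl (formDr vL2O p2 W1 p2) xx.
    have := ler_norm (d ^- 2 * ip Omega pot.1 V.1); have := ler_norm (vip Omega pot.2 V.2).
    have := ler_norm (- vip Omega pot.2 W.1); rewrite normrN.
    move: b1 b2 b3'; rewrite -/V -/W mulNr.
    move: (_ * ip _ _ _) (vip _ _ V.2) (vip _ _ W.1) => a b c; lra.
  have [->|xn0] := eqVneq x 0; first by rewrite !addr_ge0 ?vnorm2_ge0.
  by rewrite expr2 ler_pM2l// lt_neqAle eq_sym xn0.
have ale : d^-1 * norm2 Omega (fld u) <= x + D.
  rewrite ler_pdivrMl// mulrDr efd (le_trans (norm2D p1 (prehilbertZ L2O _ W2)))//.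
  rewrite lerD// norm2Z// ger0_norm ?sqr_ge0// /D mulrA -expr2//.
have sle : vnorm2 Omega (flux u) <= x + t by rewrite efl; exact: vnorm2D.
have ple : norm_12 d Omega (fld_trace u) ^+ 2 <= 2 * x ^+ 2.
  apply: (@le_trans _ _ (norm_H1 d Omega pot ^+ 2)).
    rewrite ler_pXn2r// ?nnegrE ?norm_12_ge0 ?norm_H1_ge0//.
    apply: norm_12_le => //; exact: (tr_grad_potential Uu zu).
  rewrite norm_H1_sqr /form_H1 /pair_form mul1r xx mulr_natl mulr2n lerD2r.
  rewrite -norm2_sqr ler_pdivrMl// -exprMn ler_pXn2r// nnegrE ?norm2_ge0//.
  by rewrite mulr_ge0// ltW.
have qle : norm_m12 d Omega (flux_trace u) ^+ 2 <= (x + t + g) ^+ 2 + m ^+ 2.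
  apply: (@le_trans _ _ (norm_Hdiv d Omega cf ^+ 2)).
    rewrite ler_pXn2r// ?nnegrE ?norm_m12_ge0 ?norm_Hdiv_ge0//.
    apply: norm_m12_le => //; exact: (tr_div_conforming_flux Uu zu).
  rewrite norm_Hdiv_sqr /form_Hdiv /pair_form mul1r -norm2_sqr -vnorm2_sqr lerD//.
    apply: (sqr_homo (vnorm2_ge0 _)).
    apply: le_trans (vnorm2D Ls (prehilbertN vL2O V2)) _; rewrite (vnorm2N V2).
    exact: lerD sle (lexx _).
  rewrite norm2Z// normrN gtr0_norm// -/V nV1 -exprMn.
  by rewrite le_eqVlt; apply/orP; left; apply/eqP; field; rewrite gt_eqF.
have := energy_arith m0 (vnorm2_ge0 V.2) (vnorm2_ge0 W.1) D0 x0 _ (vnorm2_ge0 (flux u)) xle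
  ale sle ple qle.
move=> /(_ (mulr_ge0 (ltW _) (norm2_ge0 _))); rewrite invr_gt0 => /(_ d0).
rewrite norm_U_sqr exprMn exprVn => /le_trans; apply.
rewrite ip_VE /form_H1 /form_Hdiv /pair_form !mul1r -!norm2_sqr -!vnorm2_sqr.
rewrite /m /D -/V -/W !exprMn exprVn; lra.
Qed.

End stability.

Lemma quasi_optimality (Uh : set (trial T)) f :
  fin_dim_subspace Omega Uh ->
  (forall v, H10 Omega v -> norm2 Omega v.1 <= d * vnorm2 Omega v.2) ->
  forall u : trial T, U_space Omega u ->
  (forall v : test T, bform u v = load f v) ->
  forall uh : trial T, Uh uh ->
  (forall v : test T, Theta_image d Uh v -> bform uh v = load f v) ->
  forall w : trial T, Uh w -> norm_U d Omega (u - uh) <= 9 * norm_U d Omega (u - w).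
Proof.
move=> fUh poincare u Uu ue uh Uuh uhe w Uw.
have sub q : Uh q -> U_space Omega q by case: fUh => [k [e [_ ->]]] [].
have Ue := U_space_sub Uu (sub _ Uuh).
have Uuw := U_space_sub Uu (sub _ Uw).
have Uhw := fin_dim_sub fUh Uuh Uw.
have [ze zeP] := theta_exists Ue.
have [zh zhP] := theta_exists (sub _ Uhw).
(* the discrete equations, tested with an image of the discrete space *)
have galerkin : bform (u - uh) zh = 0.
  rewrite (bformB _ Uu (sub _ Uuh)) ue uhe ?subrr//.
  by exists (uh - w).
have sym : ip_V d zh ze = ip_V d ze zh.
  have K1 a := glue_H1_L2grad a; have K2 a := glue_Hdiv_L2div a.
  by rewrite !ip_VE (formC fH (K1 _) (K1 _)) (formC fD (K2 _) (K2 _)).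
(* the energy of the error does not see the discrete part of the argument *)
have e2 : ip_V d ze ze = bform (u - w) ze.
  rewrite (zeP ze) (_ : u - w = (u - uh) - (w - uh)); last by rewrite opprB addrA subrK.
  rewrite (bformB _ Ue (U_space_sub (sub _ Uw) (sub _ Uuh))).
  rewrite (bformB _ (sub _ Uw) (sub _ Uuh)).
  have := zhP ze; rewrite sym zeP galerkin (bformB _ (sub _ Uuh) (sub _ Uw)).
  move=> /esym/eqP; rewrite subr_eq0 => /eqP ->; rewrite subrr subr0//.
have ze0 : 0 <= ip_V d ze ze.
  rewrite ip_VE addr_ge0//; [apply: (form_ge0 fH)|apply: (form_ge0 fD)].
    exact: glue_H1_L2grad.
  exact: glue_Hdiv_L2div.
have b := bform_bounded ze Uuw; rewrite -e2 in b.
have s := stability Ue zeP poincare.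
have zle : ip_V d ze ze <= 3 * norm_U d Omega (u - w) ^+ 2.
  move: b; have [->|zn0] := eqVneq (ip_V d ze ze) 0.
    by move=> _; apply: mulr_ge0 => //; exact: sqr_ge0.
  by rewrite expr2 ler_pM2r// lt_neqAle eq_sym zn0.
have n0 a : 0 <= norm_U d Omega a by exact: sqrtr_ge0.
rewrite -(ler_pXn2r (n := 2))// ?nnegrE ?mulr_ge0// exprMn.
apply: le_trans s _; have := sqr_ge0 (norm_U d Omega (u - w)); lra.
Qed.

End broken_formulation.

Theorem theorem4 (R : realType) (n : nat) (n23 : n = 2%N \/ n = 3%N)
    (Omega : set 'rV[R]_n) (N : nat) (T : 'I_N -> set 'rV[R]_n)
    (f : 'rV[R]_n -> R) (Uh : set (trial T)) (d : R) :
  bounded_set Omega -> polyhedral Omega -> lipschitz_domain Omega ->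
  mesh Omega T ->
  L2 Omega f ->
  fin_dim_subspace Omega Uh ->
  0 < d ->
  (forall v, H10 Omega v -> norm2 Omega v.1 <= d * vnorm2 Omega v.2) ->
  forall u : trial T, U_space Omega u ->
  (forall v : test T, bform u v = load f v) ->
  forall uh : trial T, Uh uh ->
  (forall v : test T, Theta_image d Uh v -> bform uh v = load f v) ->
  norm_U d Omega (u - uh) <= 9 * inf [set norm_U d Omega (u - w) | w in Uh].
Proof.
move=> bO _ lO mT _ fUh d0 poincare u Uu ue uh Uuh uhe.
rewrite mulrC -ler_pdivrMr//; apply: lb_le_inf.
  by exists (norm_U d Omega (u - uh)), uh.
move=> _ [w Uw <-]; rewrite ler_pdivrMr// mulrC.
exact: (quasi_optimality bO lO mT d0 fUh poincare Uu ue Uuh uhe Uw).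
Qed.
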